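(* In $\mathsf{ZF}$, $\mathsf{PFA}$ implies $\mathsf{DC}_{\omega_1}$.
   Context: Base theory: $\mathsf{ZF}$. A tree is a well-founded partial order whose lower cones are chains; it is $\kappa$-closed if for every $\alpha<\kappa$ every increasing sequence of nodes indexed by $\alpha$ has an upper bound. For an infinite (well-ordered) cardinal $\kappa$, $\mathsf{DC}_\kappa$ is the statement that every $\kappa$-closed tree without maximal elements has a chain of order type $\kappa$. A notion of forcing is a partially ordered set $\mathbb{P}$ with a maximum $1_{\mathbb{P}}$; $q\le p$ means $q$ is stronger. ''Countable'' means injectable into $\omega$. For sets $x,y$ write $|x|\le^*|y|$ if $x$ is empty or there is a surjection from $y$ onto $x$. For a well-ordered cardinal $\kappa$, $H(\kappa)=\{y : |\kappa|\not\le^*|\mathrm{tcl}(y)|\}$. Given a countable $M\prec (H(\kappa),\in,\mathbb{P})$, a condition $q\in\mathbb{P}$ is $M$-generic if for every open dense $D\subseteq\mathbb{P}$ with $D\in M$, $D\cap M$ is predense below $q$. $\mathbb{P}$ is proper if for all sufficiently large cardinals $\kappa$ (i.e. for a tail of $\kappa$) and every countable elementary submodel $M\prec (H(\kappa),\in,\mathbb{P})$, every $p\in\mathbb{P}\cap M$ has an extension $q\le p$ which is $M$-generic. $\mathsf{PFA}$ (the Proper Forcing Axiom) states: if $\mathbb{P}$ is a proper forcing, then for every collection $\mathcal{D}=\{D_\alpha\mid\alpha<\omega_1\}$ of dense open subsets of $\mathbb{P}$ there exists a $\mathcal{D}$-generic filter, i.e. a filter on $\mathbb{P}$ meeting every $D_\alpha$.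 *)

(* Defs.v *)
(* ZF is handled semantically: a model is a type with a binary relation that
   satisfies the axioms of ZF, the two schemes being stated for first-order
   formulas with parameters.  Every set-theoretic notion below is a first-order
   property of the model: all quantifiers over sets range over its carrier, so
   the notions are evaluated inside the model, whose omega may be nonstandard.
   Only the Stdlib prelude is used. *)

Set Implicit Arguments.
Unset Strict Implicit.

Record set_structure : Type := SetStructure {
  carrier :> Type;
  mem : carrier -> carrier -> Prop
}.
Arguments mem {s} _ _.

Declare Scope model_scope.
Delimit Scope model_scope with model.
Infix "∈" := mem (at level 70, no associativity) : model_scope.
Local Open Scope model_scope.

(** * The theory ZF *)

(* De Bruijn indices; [fEx] binds index 0. *)
Inductive formula : Type :=
| fMem (i j : nat)
| fEq (i j : nat)
| fNot (phi : formula)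
| fAnd (phi psi : formula)
| fEx (phi : formula).

Definition scons {V : Type} (x : V) (e : nat -> V) (n : nat) : V :=
  match n with
  | O => x
  | S m => e m
  end.

Fixpoint sat {V : set_structure} (e : nat -> V) (phi : formula) : Prop :=
  match phi with
  | fMem i j => e i ∈ e j
  | fEq i j => e i = e j
  | fNot phi => ~ sat e phi
  | fAnd phi psi => sat e phi /\ sat e psi
  | fEx phi => exists x : V, sat (scons x e) phi
  end.

Section SetNotions.
Context {V : set_structure}.
Implicit Types a b c f p q r s t u v w x y z : V.

Definition subset x y : Prop := forall z, z ∈ x -> z ∈ y.
Definition is_empty x : Prop := forall z, ~ z ∈ x.
Definition is_upair p x y : Prop := forall z, z ∈ p <-> z = x \/ z = y.
Definition is_succ y x : Prop := forall z, z ∈ y <-> z ∈ x \/ z = x.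

Definition inductive x : Prop :=
  (exists y, is_empty y /\ y ∈ x) /\
  (forall y, y ∈ x -> exists z, is_succ z y /\ z ∈ x).

End SetNotions.

Record ZF (V : set_structure) : Prop := {
  ZF_extensionality : forall x y : V, (forall z, z ∈ x <-> z ∈ y) -> x = y;
  ZF_foundation : forall x : V, (exists y, y ∈ x) ->
    exists y, y ∈ x /\ forall z, z ∈ x -> ~ z ∈ y;
  ZF_pairing : forall x y : V, exists p, is_upair p x y;
  ZF_union : forall x : V, exists y, forall z,
    z ∈ y <-> exists u, u ∈ x /\ z ∈ u;
  ZF_power : forall x : V, exists y, forall z, z ∈ y <-> subset z x;
  ZF_infinity : exists x : V, inductive x;
  ZF_separation : forall (phi : formula) (e : nat -> V) (x : V),
    exists y, forall z, z ∈ y <-> z ∈ x /\ sat (scons z e) phi;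
  ZF_replacement : forall (phi : formula) (e : nat -> V) (x : V),
    (forall u, u ∈ x -> forall v v',
       sat (scons u (scons v e)) phi -> sat (scons u (scons v' e)) phi ->
       v = v') ->
    exists y, forall v,
      v ∈ y <-> exists u, u ∈ x /\ sat (scons u (scons v e)) phi
}.

Section Notions.
Context {V : set_structure}.
Implicit Types a b c e f h i k l m n p q r s t u v w x y z : V.
Implicit Types A B C D F G K L M N P Q R S T X Z : V.

(** * Functions, ordinals, cardinals *)

(* Kuratowski pairs *)
Definition is_opair p x y : Prop :=
  exists u v, is_upair u x x /\ is_upair v x y /\ is_upair p u v.

Definition related R x y : Prop := exists p, is_opair p x y /\ p ∈ R.

Definition relation_on R A : Prop :=
  forall p, p ∈ R -> exists x y, x ∈ A /\ y ∈ A /\ is_opair p x y.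

Definition is_function f A B : Prop :=
  (forall p, p ∈ f -> exists x y, x ∈ A /\ y ∈ B /\ is_opair p x y) /\
  (forall x, x ∈ A -> exists! y, related f x y).

Definition injective f : Prop :=
  forall x x' y, related f x y -> related f x' y -> x = x'.

Definition onto f B : Prop := forall y, y ∈ B -> exists x, related f x y.

Definition transitive x : Prop := forall y, y ∈ x -> subset y x.

Definition ordinal x : Prop :=
  transitive x /\ forall y z, y ∈ x -> z ∈ x -> y ∈ z \/ y = z \/ z ∈ y.

Definition cardinal k : Prop :=
  ordinal k /\
  forall a, a ∈ k -> ~ exists f, is_function f a k /\ injective f /\ onto f k.

Definition is_omega w : Prop :=
  inductive w /\ forall x, inductive x -> subset w x.

Definition countable x : Prop :=
  exists w f, is_omega w /\ is_function f x w /\ injective f.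

Definition is_omega1 k : Prop :=
  ordinal k /\ ~ countable k /\ forall a, a ∈ k -> countable a.

Definition le_star x y : Prop :=
  is_empty x \/ exists f, is_function f y x /\ onto f x.

(** * Trees and dependent choice *)

Definition partial_order P L : Prop :=
  relation_on L P /\
  (forall x, x ∈ P -> related L x x) /\
  (forall x y, related L x y -> related L y x -> x = y) /\
  (forall x y z, related L x y -> related L y z -> related L x z).

Definition strictly L x y : Prop := related L x y /\ x <> y.

Definition tree T L : Prop :=
  partial_order T L /\
  (forall X, subset X T -> (exists x, x ∈ X) ->
     exists x, x ∈ X /\ forall y, y ∈ X -> ~ strictly L y x) /\
  (forall t x y, related L x t -> related L y t ->
     related L x y \/ related L y x).

Definition increasing f L : Prop :=
  forall a b x y, a ∈ b -> related f a x -> related f b y -> strictly L x y.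

(* For [a] empty this says that the tree is nonempty. *)
Definition closed_tree k T L : Prop :=
  forall a f, a ∈ k -> is_function f a T -> increasing f L ->
    exists t, t ∈ T /\ forall b x, related f b x -> related L x t.

Definition no_maximal T L : Prop :=
  forall t, t ∈ T -> exists s, s ∈ T /\ strictly L t s.

Definition chain C L : Prop :=
  forall x y, x ∈ C -> y ∈ C -> related L x y \/ related L y x.

Definition has_order_type C L k : Prop :=
  exists f, is_function f k C /\ injective f /\ onto f C /\
    forall a b x y, related f a x -> related f b y ->
      (a ∈ b <-> strictly L x y).

Definition DC k : Prop :=
  forall T L, tree T L -> closed_tree k T L -> no_maximal T L ->
    exists C, subset C T /\ chain C L /\ has_order_type C L k.

(** * Internal formulas and elementary submodels *)

(* Formulas of the language with membership, equality and one constant symbol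
   are coded by sets of the model: the variable with index [i] in omega is
   (0,i), the constant is (1,0), and the formulas s ∈ t, s = t, ~ x, x /\ y,
   "exists v_i, x" are (0,(s,t)), (1,(s,t)), (2,x), (3,(x,y)), (4,(i,x)). *)

Fixpoint is_numeral (n : nat) x : Prop :=
  match n with
  | O => is_empty x
  | S n' => exists y, is_numeral n' y /\ is_succ x y
  end.

Definition is_tagged (n : nat) z x : Prop :=
  exists t, is_numeral n t /\ is_opair z t x.

Definition is_tagged2 (n : nat) z x y : Prop :=
  exists p, is_opair p x y /\ is_tagged n z p.

Definition var_code t i : Prop := is_tagged 0 t i.
Definition cst_code t : Prop := exists e, is_empty e /\ is_tagged 1 t e.
Definition mem_code z s t : Prop := is_tagged2 0 z s t.
Definition eq_code z s t : Prop := is_tagged2 1 z s t.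
Definition not_code z x : Prop := is_tagged 2 z x.
Definition and_code z x y : Prop := is_tagged2 3 z x y.
Definition ex_code z i x : Prop := is_tagged2 4 z i x.

Definition term_code w t : Prop :=
  (exists i, i ∈ w /\ var_code t i) \/ cst_code t.

Definition formula_closed w X : Prop :=
  (forall s t z, term_code w s -> term_code w t ->
     mem_code z s t \/ eq_code z s t -> z ∈ X) /\
  (forall x z, x ∈ X -> not_code z x -> z ∈ X) /\
  (forall x y z, x ∈ X -> y ∈ X -> and_code z x y -> z ∈ X) /\
  (forall i x z, i ∈ w -> x ∈ X -> ex_code z i x -> z ∈ X).

(* Sets [X] closed under the formation rules exist in ZF (for instance the
   hereditarily finite sets). *)
Definition formula_code w z : Prop := forall X, formula_closed w X -> z ∈ X.

(* [c] is the interpretation of the constant, [a] : omega -> N an assignment. *)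
Definition value c a t v : Prop :=
  (exists i, var_code t i /\ related a i v) \/ (cst_code t /\ v = c).

Definition agree_off w i a b : Prop :=
  forall j v, j ∈ w -> j <> i -> (related a j v <-> related b j v).

(* [S] obeys Tarski's clauses for the structure (N, ∈, c). *)
Definition satisfaction w N c S : Prop :=
  forall a, is_function a w N ->
    (forall s t z, term_code w s -> term_code w t -> mem_code z s t ->
       (related S z a <->
        exists u v, value c a s u /\ value c a t v /\ u ∈ v)) /\
    (forall s t z, term_code w s -> term_code w t -> eq_code z s t ->
       (related S z a <->
        exists u v, value c a s u /\ value c a t v /\ u = v)) /\
    (forall x z, formula_code w x -> not_code z x ->
       (related S z a <-> ~ related S x a)) /\
    (forall x y z, formula_code w x -> formula_code w y -> and_code z x y ->
       (related S z a <-> related S x a /\ related S y a)) /\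
    (forall i x z, i ∈ w -> formula_code w x -> ex_code z i x ->
       (related S z a <->
        exists b, is_function b w N /\ agree_off w i a b /\ related S x b)).

Definition models w N c z a : Prop :=
  exists S, satisfaction w N c S /\ related S z a.

(* (M, ∈, c) is an elementary substructure of (N, ∈, c). *)
Definition elementary M N c : Prop :=
  c ∈ M /\ subset M N /\
  forall w, is_omega w ->
  forall z a, formula_code w z -> is_function a w M ->
    (models w M c z a <-> models w N c z a).

(** * Proper forcing *)

Definition is_tcl t x : Prop :=
  subset x t /\ transitive t /\
  forall y, subset x y -> transitive y -> subset t y.

Definition is_H h k : Prop :=
  forall y, y ∈ h <-> exists t, is_tcl t y /\ ~ le_star k t.

(* The poset with underlying set [P] and order [L] is the single set
   [Q] = (P, L); [related L q p] means that q is stronger than p. *)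
Definition forcing Q P L : Prop :=
  is_opair Q P L /\ partial_order P L /\
  exists o, o ∈ P /\ forall p, p ∈ P -> related L p o.

Definition dense_open P L D : Prop :=
  subset D P /\
  (forall p, p ∈ P -> exists d, d ∈ D /\ related L d p) /\
  (forall d p, d ∈ D -> related L p d -> p ∈ D).

Definition compatible L p q : Prop :=
  exists r, related L r p /\ related L r q.

Definition generic_condition M P L q : Prop :=
  q ∈ P /\
  forall D, D ∈ M -> dense_open P L D ->
    forall r, related L r q -> exists d, d ∈ D /\ d ∈ M /\ compatible L d r.

Definition proper Q P L : Prop :=
  exists k0, cardinal k0 /\
  forall k, cardinal k -> subset k0 k ->
  forall h M, is_H h k -> countable M -> elementary M h Q ->
  forall p, p ∈ P -> p ∈ M ->
    exists q, related L q p /\ generic_condition M P L q.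

Definition filter P L G : Prop :=
  subset G P /\ (exists p, p ∈ G) /\
  (forall p q, p ∈ G -> related L p q -> q ∈ G) /\
  (forall p q, p ∈ G -> q ∈ G ->
     exists r, r ∈ G /\ related L r p /\ related L r q).

End Notions.

Definition PFA (V : set_structure) : Prop :=
  forall Q P L : V, forcing Q P L -> proper Q P L ->
  forall w1 Z F : V, is_omega1 w1 -> is_function F w1 Z ->
    (forall a D, related F a D -> dense_open P L D) ->
    exists G, filter P L G /\
      forall a D, related F a D -> exists g, g ∈ G /\ g ∈ D.

Definition DC_omega1 (V : set_structure) : Prop :=
  forall w1 : V, is_omega1 w1 -> DC w1.

(* Main.v *)
(* A poset without minimal elements in which descending omega-sequences have
   lower bounds is proper already in ZF: a countable elementary submodel M comes
   with an enumeration, so a descending sequence through the dense sets of M can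
   be built by always taking the eligible condition of M of least index.  A cone
   of an omega1-closed tree, turned upside down, is such a poset, and a filter on
   it is a chain of the tree.

   By induction on a < omega1, every node has an extension above a node of height
   a.  At stage a, PFA in the cone of t gives a chain G through t with nodes of
   every height b < a below it; these form an increasing a-sequence, which either
   lies below t or has an upper bound above t.  So the induction needs no
   dependent choice at limits, and the same argument with a = omega1 gives the
   branch.

   Properness speaks of internal elementarity, so one needs that internal
   satisfaction relations exist; otherwise elementarity would be vacuous. *)

(* The model has separation and replacement only for first-order formulas, and its omega may be
   nonstandard. So sets are cut out by predicates shown to be definable, and recursion along omega
   is carried out inside the model, by fixed points or approximating sets of pairs, never over
   [nat]. The satisfaction relation must treat all codes of the model, including those that come
   from no formula outside it; elementarity is then applied to concrete formulas only, saying that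
   one condition is strictly stronger than another and possibly lies in a given dense set.

   Strictness matters because closure of a tree speaks of strictly increasing sequences; this is
   where the absence of minimal conditions enters. The sequence of nodes of heights b < a is
   definable from the generic chain because at most one node of each height lies under a chain. An
   upper bound of that sequence may be too high; well-foundedness yields a minimal node above the
   whole sequence, and its height is exactly a. *)
From Stdlib Require Import Classical ClassicalEpsilon Arith Lia List.
Require Import Defs.

Local Open Scope model_scope.

(** * Definability with parameters *)

(* [formula] has no parameters; allowing elements of the model as terms makes
   "definable with parameters" closed under the connectives by construction. *)
Inductive pterm (V : Type) : Type :=
| PVar (n : nat)
| PCst (c : V).

Inductive pformula (V : Type) : Type :=
| PMem (s t : pterm V)
| PEq (s t : pterm V)
| PNot (phi : pformula V)
| PAnd (phi psi : pformula V)
| PEx (phi : pformula V).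

Arguments PVar {V} n.
Arguments PCst {V} c.
Arguments PMem {V} s t.
Arguments PEq {V} s t.
Arguments PNot {V} phi.
Arguments PAnd {V} phi psi.
Arguments PEx {V} phi.

Definition pval {V : Type} (e : nat -> V) (t : pterm V) : V :=
  match t with PVar n => e n | PCst c => c end.

Fixpoint psat {V : set_structure} (e : nat -> V) (phi : pformula V) : Prop :=
  match phi with
  | PMem s t => pval e s ∈ pval e t
  | PEq s t => pval e s = pval e t
  | PNot phi => ~ psat e phi
  | PAnd phi psi => psat e phi /\ psat e psi
  | PEx phi => exists x : V, psat (scons x e) phi
  end.

Definition tparams {V : Type} (t : pterm V) : list V :=
  match t with PVar _ => nil | PCst c => c :: nil end.

Fixpoint params {V : Type} (phi : pformula V) : list V :=
  match phi with
  | PMem s t | PEq s t => tparams s ++ tparams t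
  | PNot phi | PEx phi => params phi
  | PAnd phi psi => params phi ++ params psi
  end.

(* Under [d] binders: bound variables are kept, the two free variables become
   [d] and [d + 1] (all further free variables are identified with the second),
   and the [m]-th parameter becomes the variable [d + 2 + m]. *)
Definition tvar {V : Type} (d m : nat) (t : pterm V) : nat :=
  match t with
  | PVar n => if n <? d then n else d + Nat.min (n - d) 1
  | PCst _ => d + 2 + m
  end.

Fixpoint unparam {V : Type} (d m : nat) (phi : pformula V) : formula :=
  match phi with
  | PMem s t => fMem (tvar d m s) (tvar d (m + length (tparams s)) t)
  | PEq s t => fEq (tvar d m s) (tvar d (m + length (tparams s)) t)
  | PNot phi => fNot (unparam d m phi)
  | PAnd phi psi =>
      fAnd (unparam d m phi) (unparam d (m + length (params phi)) psi)
  | PEx phi => fEx (unparam (S d) m phi)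
  end.

Lemma tvar_bound {V : Type} d n :
  tvar (S d) 0 (@PVar V (S n)) = S (tvar d 0 (@PVar V n)).
Proof.
  simpl. change (S n <? S d) with (n <? d). destruct (n <? d); lia.
Qed.

Lemma tvar_correct {V : Type} (E e : nat -> V) x0 d m t :
  (forall n, E (tvar d 0 (@PVar V n)) = e n) ->
  (forall j, j < length (tparams t) -> E (d + 2 + (m + j)) = nth j (tparams t) x0) ->
  E (tvar d m t) = pval e t.
Proof.
  intros Hv Hc. destruct t as [n|c]; simpl in *.
  - apply Hv.
  - rewrite <- (Hc 0) by lia. f_equal. lia.
Qed.

(** The offset [m] lets the two halves of a binary connective read consecutive blocks of one
    parameter list, while [d] follows the binders. *)
Lemma unparam_correct {V : set_structure} (x0 : V) phi : forall d m (E e : nat -> V),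
  (forall n, E (tvar d 0 (@PVar V n)) = e n) ->
  (forall j, j < length (params phi) ->
     E (d + 2 + (m + j)) = nth j (params phi) x0) ->
  sat E (unparam d m phi) <-> psat e phi.
Proof.
  assert (Happ : forall (E : nat -> V) d m l l',
    (forall j, j < length (l ++ l') -> E (d + 2 + (m + j)) = nth j (l ++ l') x0) ->
    (forall j, j < length l -> E (d + 2 + (m + j)) = nth j l x0) /\
    (forall j, j < length l' -> E (d + 2 + (m + length l + j)) = nth j l' x0)).
  { intros E d m l l' H. rewrite length_app in H. split; intros j Hj.
    - rewrite H by lia. now apply app_nth1.
    - replace (m + length l + j) with (m + (length l + j)) by lia.
      rewrite H by lia. rewrite app_nth2 by lia. f_equal. lia. }
  induction phi as [s t|s t|phi IH|phi IH psi IH'|phi IH];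
    intros d m E e Hv Hc; simpl in Hc |- *.
  - destruct (Happ _ _ _ _ _ Hc) as [H1 H2].
    now rewrite (tvar_correct E e x0 _ _ s Hv H1), (tvar_correct E e x0 _ _ t Hv H2).
  - destruct (Happ _ _ _ _ _ Hc) as [H1 H2].
    now rewrite (tvar_correct E e x0 _ _ s Hv H1), (tvar_correct E e x0 _ _ t Hv H2).
  - now rewrite (IH d m E e).
  - destruct (Happ _ _ _ _ _ Hc) as [H1 H2].
    now rewrite (IH d m E e Hv H1), (IH' d _ E e Hv H2).
  - assert (H : forall x,
      sat (scons x E) (unparam (S d) m phi) <-> psat (scons x e) phi).
    { intros x. apply IH.
      - intros [|n]; [reflexivity|]. rewrite tvar_bound. exact (Hv n).
      - exact Hc. }
    split; intros [x Hx]; exists x; now apply H.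
Qed.

(** Stated for predicates of whole assignments, so that definability can be proved along the shape
    of a Rocq proposition: a variable is a projection, and a quantifier shifts the assignment. *)
Definition definable {V : set_structure} (P : (nat -> V) -> Prop) : Prop :=
  exists phi : pformula V, forall e, psat e phi <-> P e.

Definition is_term {V : set_structure} (t : (nat -> V) -> V) : Prop :=
  exists s : pterm V, forall e, pval e s = t e.

Section Definability.
Context {V : set_structure}.
Implicit Types P Q : (nat -> V) -> Prop.

Lemma is_term_var k : is_term (fun e : nat -> V => e k).
Proof. now exists (PVar k). Qed.

Lemma is_term_cst (c : V) : is_term (fun _ => c).
Proof. now exists (PCst c). Qed.

Lemma definable_mem s t : is_term s -> is_term t ->
  @definable V (fun e => s e ∈ t e).
Proof.
  intros [s' Hs] [t' Ht]. exists (PMem s' t'). intros e. simpl.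
  now rewrite Hs, Ht.
Qed.

Lemma definable_eq s t : is_term s -> is_term t ->
  @definable V (fun e => s e = t e).
Proof.
  intros [s' Hs] [t' Ht]. exists (PEq s' t'). intros e. simpl.
  now rewrite Hs, Ht.
Qed.

Lemma definable_not P : definable P -> definable (fun e => ~ P e).
Proof.
  intros [phi H]. exists (PNot phi). intros e. simpl. now rewrite H.
Qed.

Lemma definable_and P Q : definable P -> definable Q ->
  definable (fun e => P e /\ Q e).
Proof.
  intros [phi H] [psi H']. exists (PAnd phi psi). intros e. simpl.
  now rewrite H, H'.
Qed.

Lemma definable_ex (P : V -> (nat -> V) -> Prop) :
  definable (fun e => P (e 0) (fun n => e (S n))) ->
  definable (fun e => exists x, P x e).
Proof.
  intros [phi H]. exists (PEx phi). intros e. simpl.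
  split; intros [x Hx]; exists x; now apply (H (scons x e)).
Qed.

Lemma definable_ext P Q : (forall e, P e <-> Q e) -> definable P -> definable Q.
Proof.
  intros H [phi Hphi]. exists phi. intros e. now rewrite Hphi.
Qed.

Lemma definable_imp P Q : definable P -> definable Q ->
  definable (fun e => P e -> Q e).
Proof.
  intros H H'. apply definable_ext with (fun e => ~ (P e /\ ~ Q e)).
  - intros e. tauto.
  - now apply definable_not, definable_and, definable_not.
Qed.

Lemma definable_or P Q : definable P -> definable Q ->
  definable (fun e => P e \/ Q e).
Proof.
  intros H H'. apply definable_ext with (fun e => ~ (~ P e /\ ~ Q e)).
  - intros e. tauto.
  - now apply definable_not, definable_and; apply definable_not.
Qed.

Lemma definable_all (P : V -> (nat -> V) -> Prop) :
  definable (fun e => P (e 0) (fun n => e (S n))) ->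
  definable (fun e => forall x, P x e).
Proof.
  intros H. apply definable_ext with (fun e => ~ exists x, ~ P x e).
  - intros e. split; [intros H' x; apply NNPP|]; firstorder.
  - now apply definable_not, (definable_ex (fun x e => ~ P x e)), definable_not.
Qed.

End Definability.

Ltac splits := repeat match goal with |- _ /\ _ => split end.

(** Defined notions such as [ordinal] get no lemmas of their own: unification unfolds them until a
    connective or an atom appears. *)
Ltac solve_definable :=
  cbv beta;
  first
  [ assumption
  | apply is_term_var | apply is_term_cst
  | apply definable_mem; solve_definable
  | apply definable_eq; solve_definable
  | apply definable_not; solve_definable
  | apply definable_and; solve_definable
  | apply definable_or; solve_definable
  | apply definable_imp; solve_definable
  | apply definable_ex; solve_definable
  | apply definable_all; solve_definable ].

(** * Separation and replacement for definable predicates *)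

Section Model.
Context {V : set_structure} (hZF : ZF V).

Lemma separation (Q : V -> Prop) x : definable (fun e => Q (e 0)) ->
  exists y, forall z, z ∈ y <-> z ∈ x /\ Q z.
Proof.
  intros [phi H].
  destruct (ZF_separation hZF (unparam 0 0 phi)
              (scons x (fun j => nth j (params phi) x)) x) as [y Hy].
  exists y. intros z. rewrite Hy.
  (* Variable 0 is the element and variable 1 a dummy, here [x], with which all further free
     variables are identified; the parameters start at 2. *)
  rewrite (unparam_correct x phi 0 0 _ (scons z (fun _ => x))).
  - now rewrite H.
  - intros [|n]; [reflexivity|]. simpl. now destruct n.
  - reflexivity.
Qed.

Lemma replacement (Q : V -> V -> Prop) x : definable (fun e => Q (e 0) (e 1)) ->
  (forall u, u ∈ x -> forall v v', Q u v -> Q u v' -> v = v') ->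
  exists y, forall v, v ∈ y <-> exists u, u ∈ x /\ Q u v.
Proof.
  intros [phi H] Hfun.
  assert (Hsat : forall u v,
    sat (scons u (scons v (fun j => nth j (params phi) x))) (unparam 0 0 phi)
    <-> Q u v).
  { intros u v. rewrite (unparam_correct x phi 0 0 _ (scons u (fun _ => v))).
    - now rewrite H.
    - intros [|n]; [reflexivity|]. simpl. now destruct n.
    - reflexivity. }
  destruct (@ZF_replacement V hZF (unparam 0 0 phi) (fun j => nth j (params phi) x) x)
    as [y Hy].
  - intros u Hu v v' Hv Hv'. apply Hsat in Hv, Hv'. eauto.
  - exists y. intros v. rewrite Hy.
    split; intros (u & Hu & Hv); exists u; split; trivial; now apply Hsat.
Qed.



(** * Basic sets *)

(** It only names objects determined by their specification (ordered pairs, numerals, values of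
    functions), so it brings no choice into the model. *)
Definition the (Q : V -> Prop) (x0 : V) : V := epsilon (inhabits x0) Q.

Lemma upair_exists (x y : V) : exists p, is_upair p x y.
Proof. exact (ZF_pairing hZF x y). Qed.

Lemma upair_unique (p q x y : V) : is_upair p x y -> is_upair q x y -> p = q.
Proof.
  intros H H'. apply (ZF_extensionality hZF). intros z.
  now rewrite (H z), (H' z).
Qed.

Lemma opair_exists (x y : V) : exists p, is_opair p x y.
Proof.
  destruct (upair_exists x x) as [u Hu], (upair_exists x y) as [v Hv].
  destruct (upair_exists u v) as [p Hp]. now exists p, u, v.
Qed.

Lemma opair_unique (p q x y : V) : is_opair p x y -> is_opair q x y -> p = q.
Proof.
  intros (u & v & Hu & Hv & Hp) (u' & v' & Hu' & Hv' & Hq).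
  rewrite (upair_unique _ _ _ _ Hu' Hu) in Hq.
  rewrite (upair_unique _ _ _ _ Hv' Hv) in Hq.
  exact (upair_unique _ _ _ _ Hp Hq).
Qed.

Lemma upair_inj (p x y x' y' : V) : is_upair p x y -> is_upair p x' y' ->
  (x = x' /\ y = y') \/ (x = y' /\ y = x').
Proof.
  intros H H'.
  pose proof (proj1 (H' x) (proj2 (H x) (or_introl eq_refl))) as Hx.
  pose proof (proj1 (H' y) (proj2 (H y) (or_intror eq_refl))) as Hy.
  pose proof (proj1 (H x') (proj2 (H' x') (or_introl eq_refl))) as Hx'.
  pose proof (proj1 (H y') (proj2 (H' y') (or_intror eq_refl))) as Hy'.
  intuition congruence.
Qed.

Lemma is_opair_inj (p x y x' y' : V) :
  is_opair p x y -> is_opair p x' y' -> x = x' /\ y = y'.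
Proof.
  intros (u & v & Hu & Hv & Hp) (u' & v' & Hu' & Hv' & Hp').
  destruct (upair_inj _ _ _ _ _ Hp Hp') as [[-> ->]|[-> ->]].
  - pose proof (upair_inj _ _ _ _ _ Hu Hu').
    pose proof (upair_inj _ _ _ _ _ Hv Hv'). intuition congruence.
  - pose proof (upair_inj _ _ _ _ _ Hu Hv').
    pose proof (upair_inj _ _ _ _ _ Hv Hu'). intuition congruence.
Qed.

Definition opair (x y : V) : V := the (fun p => is_opair p x y) x.

Lemma opair_spec x y : is_opair (opair x y) x y.
Proof. unfold opair, the. apply epsilon_spec, opair_exists. Qed.

Lemma is_opair_iff p x y : is_opair p x y <-> p = opair x y.
Proof.
  split; [intros H|intros ->; apply opair_spec].
  exact (opair_unique _ _ _ _ H (opair_spec x y)).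
Qed.

Lemma opair_inj x y x' y' : opair x y = opair x' y' -> x = x' /\ y = y'.
Proof.
  intros H. apply (is_opair_inj (opair x y)); [apply opair_spec|].
  rewrite H. apply opair_spec.
Qed.

Lemma related_iff (R x y : V) : related R x y <-> opair x y ∈ R.
Proof.
  split.
  - intros (p & Hp & HR). apply is_opair_iff in Hp. now subst.
  - intros H. exists (opair x y). split; [apply opair_spec|exact H].
Qed.

Lemma union2_exists (x y : V) : exists u, forall z, z ∈ u <-> z ∈ x \/ z ∈ y.
Proof.
  destruct (upair_exists x y) as [p Hp]. destruct (ZF_union hZF p) as [u Hu].
  exists u. intros z. rewrite Hu. split.
  - intros (v & Hv & Hz). apply Hp in Hv. destruct Hv; subst; auto.
  - intros [H|H]; [exists x|exists y]; split; trivial; apply Hp; auto.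
Qed.

Lemma product_exists (A B : V) :
  exists C, forall p, p ∈ C <-> exists x y, x ∈ A /\ y ∈ B /\ is_opair p x y.
Proof.
  destruct (union2_exists A B) as [U HU].
  destruct (ZF_power hZF U) as [PU HPU]. destruct (ZF_power hZF PU) as [PPU HPPU].
  destruct (separation (fun p => exists x y, x ∈ A /\ y ∈ B /\ is_opair p x y) PPU)
    as [C HC]; [solve_definable|].
  exists C. intros p. rewrite HC. split; [tauto|]. intros H. split; [|exact H].
  destruct H as (x & y & Hx & Hy & u & v & Hu & Hv & Hp).
  apply HPPU. intros z Hz. apply HPU. intros t Ht. apply HU.
  apply Hp in Hz. destruct Hz as [-> | ->]; [apply Hu in Ht|apply Hv in Ht];
    destruct Ht as [-> | ->]; auto.
Qed.

Lemma relation_exists (A B : V) (Q : V -> V -> Prop) :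
  definable (fun e => Q (e 0) (e 1)) ->
  exists R,
    (forall p, p ∈ R -> exists x y, x ∈ A /\ y ∈ B /\ is_opair p x y) /\
    forall x y, related R x y <-> x ∈ A /\ y ∈ B /\ Q x y.
Proof.
  intros HQ. destruct (product_exists A B) as [C HC].
  (* Binding [y] outside [x] gives [x] index 0 and [y] index 1, so the definability hypothesis on
     [Q] applies as it stands. *)
  destruct (separation (fun p => exists y x, is_opair p x y /\ Q x y) C)
    as [R HR]; [solve_definable|].
  exists R. split.
  - intros p Hp. now apply HC, HR.
  - intros x y. rewrite related_iff, HR, HC. split.
    + intros [(a & b & Ha & Hb & Hp) (y' & x' & Hp' & H)].
      destruct (is_opair_inj _ _ _ _ _ (opair_spec x y) Hp).
      destruct (is_opair_inj _ _ _ _ _ (opair_spec x y) Hp'). now subst.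
    + intros (Hx & Hy & H). split; [exists x, y|exists y, x]; auto using opair_spec.
Qed.

Lemma function_exists (A B : V) (Q : V -> V -> Prop) :
  definable (fun e => Q (e 0) (e 1)) ->
  (forall x, x ∈ A -> exists y, y ∈ B /\ Q x y) ->
  (forall x y y', x ∈ A -> y ∈ B -> y' ∈ B -> Q x y -> Q x y' -> y = y') ->
  exists f, is_function f A B /\
    forall x y, related f x y <-> x ∈ A /\ y ∈ B /\ Q x y.
Proof.
  intros HQ Hex Huniq. destruct (relation_exists A B Q HQ) as (f & Hf & H).
  exists f. split; [split; [exact Hf|]|exact H].
  intros x Hx. destruct (Hex x Hx) as (y & Hy & HQy). exists y.
  split; [now apply H|]. intros y' Hy'. apply H in Hy'.
  apply (Huniq x); tauto.
Qed.

Section Functions.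
Context {f A B : V} (Hf : is_function f A B).

Lemma function_dom x y : related f x y -> x ∈ A.
Proof.
  intros (p & Hp & H). destruct (proj1 Hf p H) as (x' & y' & Hx & Hy & Hp').
  destruct (is_opair_inj _ _ _ _ _ Hp Hp'). now subst.
Qed.

Lemma function_cod x y : related f x y -> y ∈ B.
Proof.
  intros (p & Hp & H). destruct (proj1 Hf p H) as (x' & y' & Hx & Hy & Hp').
  destruct (is_opair_inj _ _ _ _ _ Hp Hp'). now subst.
Qed.

Lemma function_total x : x ∈ A -> exists y, related f x y.
Proof. intros Hx. destruct (proj2 Hf x Hx) as (y & Hy & _). eauto. Qed.

Lemma function_unique x y y' : related f x y -> related f x y' -> y = y'.
Proof.
  intros H H'. destruct (proj2 Hf x (function_dom _ _ H)) as (y0 & _ & Hu).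
  now rewrite <- (Hu y H), <- (Hu y' H').
Qed.

End Functions.

Lemma function_mono (f A B C : V) : is_function f A B -> subset B C ->
  is_function f A C.
Proof.
  intros [Hf Hf'] HBC. split; [|exact Hf']. intros p Hp.
  destruct (Hf p Hp) as (x & y & Hx & Hy & Hxy). exists x, y. auto.
Qed.

(** * Consequences of foundation, the empty set and successors *)

Lemma mem_induction (A : V) (Q : V -> Prop) : definable (fun e => Q (e 0)) ->
  (forall x, x ∈ A -> (forall y, y ∈ x -> y ∈ A -> Q y) -> Q x) ->
  forall x, x ∈ A -> Q x.
Proof.
  intros HQ IH x Hx. apply NNPP. intros Hn.
  destruct (separation (fun x => ~ Q x) A) as [Y HY]; [solve_definable|].
  destruct (@ZF_foundation V hZF Y) as (y & Hy & Hmin).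
  { exists x. now apply HY. }
  apply HY in Hy. destruct Hy as [HyA HyQ]. apply HyQ, IH; [exact HyA|].
  intros z Hz HzA. apply NNPP. intros HzQ. apply (Hmin z); [now apply HY|exact Hz].
Qed.

Lemma mem_asym (x y : V) : x ∈ y -> ~ y ∈ x.
Proof.
  intros H H'. destruct (upair_exists x y) as [p Hp].
  destruct (@ZF_foundation V hZF p) as (z & Hz & Hmin).
  { exists x. apply Hp. auto. }
  apply Hp in Hz. destruct Hz as [-> | ->].
  - apply (Hmin y); [apply Hp; auto|exact H'].
  - apply (Hmin x); [apply Hp; auto|exact H].
Qed.

Lemma mem_irrefl (x : V) : ~ x ∈ x.
Proof. intros H. exact (mem_asym x x H H). Qed.

Lemma empty_exists (x : V) : exists y : V, is_empty y.
Proof.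
  destruct (separation (fun z => z <> z) x) as [y Hy]; [solve_definable|].
  exists y. intros z Hz. apply Hy in Hz. tauto.
Qed.

Lemma succ_exists (x : V) : exists y, is_succ y x.
Proof.
  destruct (upair_exists x x) as [s Hs], (union2_exists x s) as [y Hy].
  { exists y. intros z. rewrite Hy, (Hs z). tauto. }
Qed.

Lemma empty_unique (x y : V) : is_empty x -> is_empty y -> x = y.
Proof. intros H H'. apply (ZF_extensionality hZF). firstorder. Qed.

Lemma succ_unique (x y n : V) : is_succ x n -> is_succ y n -> x = y.
Proof.
  intros H H'. apply (ZF_extensionality hZF). intros z. now rewrite (H z), (H' z).
Qed.

Lemma succ_inj (m n n' : V) : is_succ m n -> is_succ m n' -> n = n'.
Proof.
  intros H H'. apply NNPP. intros Hne.
  assert (n ∈ n') by (destruct (proj1 (H' n)); [apply H|trivial|]; auto; tauto).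
  assert (n' ∈ n) by (destruct (proj1 (H n')) as [|]; [apply H'| |]; auto; congruence).
  now apply (mem_asym n n').
Qed.

Lemma succ_not_empty (m n : V) : is_succ m n -> ~ is_empty m.
Proof. intros H He. apply (He n), H. auto. Qed.

(** * Ordinals and omega *)

Lemma ordinal_mem (x y : V) : ordinal x -> y ∈ x -> ordinal y.
Proof.
  intros [Ht Hl] Hy. split.
  - intros z Hz u Hu. assert (Hzx : z ∈ x) by now apply (Ht y).
    assert (Hux : u ∈ x) by now apply (Ht z).
    destruct (Hl u y Hux Hy) as [H|[-> |H]]; [exact H| |].
    + now destruct (mem_asym y z).
    + exfalso.
      (* The cycle u ∈ z ∈ y ∈ u is refuted by foundation for the set of these three elements. *)
      destruct (separation (fun v => v = y \/ v = z \/ v = u) x) as [C HC];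
        [solve_definable|].
      destruct (@ZF_foundation V hZF C) as (v & Hv & Hmin).
      { exists y. apply HC. auto. }
      apply HC in Hv. destruct Hv as [_ [-> |[-> | ->]]].
      * apply (Hmin z); [apply HC; auto|exact Hz].
      * apply (Hmin u); [apply HC; auto|exact Hu].
      * apply (Hmin y); [apply HC; auto|exact H].
  - intros u v Hu Hv. apply Hl; now apply (Ht y).
Qed.

(** If [x] is not all of [y], an ∈-minimal element of [y] outside [x] has exactly the elements of
    [x]. *)
Lemma ordinal_subset (x y : V) : ordinal x -> ordinal y -> subset x y ->
  x = y \/ x ∈ y.
Proof.
  intros Hx Hy Hs. destruct (classic (x = y)) as [|Hne]; [auto|right].
  destruct (separation (fun z => ~ z ∈ x) y) as [D HD]; [solve_definable|].
  destruct (@ZF_foundation V hZF D) as (z & Hz & Hmin).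
  { apply NNPP. intros Hn. apply Hne, (ZF_extensionality hZF). intros z.
    split; [apply Hs|]. intros Hzy. apply NNPP. intros Hzx. apply Hn.
    exists z. now apply HD. }
  apply HD in Hz. destruct Hz as [Hzy Hzx].
  replace x with z; [exact Hzy|]. apply (ZF_extensionality hZF). intros u. split.
  - intros Hu. apply NNPP. intros Hux. apply (Hmin u); [|exact Hu].
    apply HD. split; [|exact Hux]. now apply (proj1 Hy z).
  - intros Hu. destruct (proj2 Hy u z (Hs u Hu) Hzy) as [H|[-> |H]]; [exact H|tauto|].
    destruct Hzx. now apply (proj1 Hx u).
Qed.

(** The intersection of [x] and [y] is an ordinal; were it an element of both, it would be an
    element of itself. *)
Lemma ordinal_total (x y : V) : ordinal x -> ordinal y -> x ∈ y \/ x = y \/ y ∈ x.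
Proof.
  intros Hx Hy.
  destruct (separation (fun z => z ∈ y) x) as [m Hm]; [solve_definable|].
  assert (Hom : ordinal m).
  { split.
    - intros z Hz u Hu. apply Hm in Hz. apply Hm.
      split; [apply (proj1 Hx z)|apply (proj1 Hy z)]; tauto.
    - intros u v Hu Hv. apply Hm in Hu, Hv. apply (proj2 Hx); tauto. }
  destruct (ordinal_subset m x Hom Hx) as [-> |H1]; [intros z Hz; now apply Hm| |].
  - destruct (ordinal_subset x y Hx Hy); auto. intros z Hz. now apply Hm.
  - destruct (ordinal_subset m y Hom Hy) as [-> |H2]; [intros z Hz; now apply Hm| |].
    + auto.
    + destruct (mem_irrefl m). now apply Hm.
Qed.

Lemma ordinal_succ (x y : V) : ordinal x -> is_succ y x -> ordinal y.
Proof.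
  intros [Ht Hl] H. split.
  - intros z Hz u Hu. apply H. left. apply H in Hz.
    destruct Hz as [Hz| ->]; [now apply (Ht z)|exact Hu].
  - intros u v Hu Hv. apply H in Hu, Hv.
    destruct Hu as [Hu| ->], Hv as [Hv| ->]; auto.
Qed.

Lemma ordinal_empty (x : V) : is_empty x -> ordinal x.
Proof. intros H. split; intros y; [|intros z]; intros Hy; now destruct (H y). Qed.

Section Omega.
Context {w : V} (Hw : is_omega w).

Lemma omega_empty (z : V) : is_empty z -> z ∈ w.
Proof.
  intros H. destruct Hw as [[(y & Hy & Hyw) _] _].
  now rewrite (empty_unique z y H Hy).
Qed.

Lemma omega_succ (n m : V) : n ∈ w -> is_succ m n -> m ∈ w.
Proof.
  intros Hn H. destruct Hw as [[_ Hs] _]. destruct (Hs n Hn) as (m' & Hm' & Hmw).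
  now rewrite (succ_unique m m' n H Hm').
Qed.

Lemma omega_induction (Q : V -> Prop) : definable (fun e => Q (e 0)) ->
  (forall z, is_empty z -> Q z) ->
  (forall n m, n ∈ w -> is_succ m n -> Q n -> Q m) ->
  forall n, n ∈ w -> Q n.
Proof.
  intros HQ H0 HS n Hn.
  destruct (separation Q w HQ) as [X HX]. apply HX.
  apply (proj2 Hw); [|exact Hn]. split.
  - destruct (empty_exists w) as [z Hz]. exists z. split; [exact Hz|].
    apply HX. auto using omega_empty.
  - intros y Hy. apply HX in Hy. destruct (succ_exists y) as [m Hm].
    exists m. split; [exact Hm|]. apply HX.
    split; [apply (omega_succ y)|apply (HS y)]; tauto.
Qed.

Lemma omega_mem_ordinal n : n ∈ w -> ordinal n.
Proof.
  apply (omega_induction ordinal).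
  - solve_definable.
  - apply ordinal_empty.
  - intros m k _ Hk Hm. exact (ordinal_succ m k Hm Hk).
Qed.

Lemma omega_transitive : transitive w.
Proof.
  refine (omega_induction (fun n => subset n w) _ _ _).
  - solve_definable.
  - intros z Hz y Hy. now destruct (Hz y).
  - intros n m Hn Hm IH y Hy. apply Hm in Hy. destruct Hy as [Hy| ->]; auto.
Qed.

Lemma omega_ordinal : ordinal w.
Proof.
  split; [exact omega_transitive|].
  intros y z Hy Hz. apply ordinal_total; now apply omega_mem_ordinal.
Qed.

Lemma omega_countable (x : V) : subset x w -> countable x.
Proof.
  intros Hx. exists w.
  destruct (function_exists x w (fun y z => y = z)) as (f & Hf & H).
  - solve_definable.
  - eauto.
  - intros. congruence.
  - exists f. splits; try apply Hw; try apply Hf.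
    intros y y' z Hy Hy'. apply H in Hy, Hy'. destruct Hy as (_ & _ & ->).
    now destruct Hy' as (_ & _ & ->).
Qed.

Lemma omega_mem_omega1 (w1 : V) : is_omega1 w1 -> w ∈ w1.
Proof.
  intros (Ho & Hnc & _).
  destruct (ordinal_total w w1 omega_ordinal Ho) as [H|[H|H]]; [exact H| |];
    destruct Hnc; apply omega_countable.
  - subst. now intros z.
  - now apply omega_transitive.
Qed.

End Omega.


(** * Recursion *)

(** Knaster-Tarski: [I] is the intersection of the closed sets. Its image [J] is contained in [I],
    hence closed by monotonicity, hence contains [I]. *)
Lemma fixpoint_exists (B : V) (Phi : V -> V -> Prop) :
  definable (fun e => Phi (e 1) (e 0)) ->
  (forall X Y p, subset X Y -> Phi X p -> Phi Y p) ->
  exists I, forall p, p ∈ I <-> p ∈ B /\ Phi I p.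
Proof.
  intros HPhi Hmono.
  destruct (separation
    (fun p => forall X, (forall q, q ∈ B -> Phi X q -> q ∈ X) -> p ∈ X) B)
    as [I HI]; [solve_definable|].
  (* The equations move [I] and [p] to bound variables with indices 1 and 0, the form in which [Phi]
     is known to be definable. *)
  destruct (separation (fun p => exists X, X = I /\ exists q, q = p /\ Phi X q) B)
    as [J HJ]; [solve_definable|].
  assert (HJ' : forall p, p ∈ J <-> p ∈ B /\ Phi I p).
  { intros p. rewrite HJ. split.
    - intros (Hp & X & -> & q & -> & H). auto.
    - intros [Hp H]. eauto 6. }
  assert (HJI : subset J I).
  { intros p Hp. apply HJ' in Hp. destruct Hp as [Hp H]. apply HI.
    split; [exact Hp|]. intros X HX. apply HX; [exact Hp|].
    apply (Hmono I); [|exact H]. intros q Hq. apply HI in Hq. now apply Hq. }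
  exists I. intros p. split.
  - intros Hp. apply HJ'. apply HI in Hp. apply Hp. intros q Hq H. apply HJ'.
    split; [exact Hq|]. now apply (Hmono J).
  - intros H. now apply HJI, HJ'.
Qed.

(** The graph is a fixed point of the operator that prescribes the value at 0 and the successor
    steps; internal induction shows that it is total and single-valued. Since [R] determines the
    next value in [A], nothing is chosen. *)
Lemma omega_recursion (w A x0 : V) (R : V -> V -> V -> Prop) :
  is_omega w -> definable (fun e => R (e 1) (e 0) (e 2)) -> x0 ∈ A ->
  (forall n x, n ∈ w -> x ∈ A -> exists y, y ∈ A /\ R n x y) ->
  (forall n x y y', n ∈ w -> x ∈ A -> y ∈ A -> y' ∈ A ->
     R n x y -> R n x y' -> y = y') ->
  exists f, is_function f w A /\ (forall z, is_empty z -> related f z x0) /\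
    forall n m x y, n ∈ w -> is_succ m n -> related f n x -> related f m y ->
      R n x y.
Proof.
  intros Hw HR Hx0 Hex Huniq.
  destruct (product_exists w A) as [B HB].
  set (Phi := fun X p => exists k v, is_opair p k v /\
    ((is_empty k /\ v = x0) \/
     exists n x, is_succ k n /\ related X n x /\ R n x v)).
  destruct (fixpoint_exists B Phi) as [I HI].
  { unfold Phi. solve_definable. }
  { intros X Y p HXY (k & v & Hp & H). exists k, v. split; [exact Hp|].
    destruct H as [H|(n & x & Hk & (q & Hq & HqX) & H)]; [auto|].
    right. exists n, x. splits; auto. exists q. auto. }
  assert (HI' : forall k v, related I k v <-> k ∈ w /\ v ∈ A /\
    ((is_empty k /\ v = x0) \/
     exists n x, is_succ k n /\ related I n x /\ R n x v)).
  { intros k v. rewrite related_iff, HI, HB. split.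
    - intros [(k' & v' & Hk & Hv & Hp) (k1 & v1 & Hp' & H)].
      destruct (is_opair_inj _ _ _ _ _ (opair_spec k v) Hp).
      destruct (is_opair_inj _ _ _ _ _ (opair_spec k v) Hp'). subst. auto.
    - intros (Hk & Hv & H). split; exists k, v; auto using opair_spec. }
  assert (Hfun : forall k, k ∈ w -> exists! v, related I k v).
  { apply (omega_induction Hw).
    - solve_definable.
    - intros z Hz. exists x0. split.
      + apply HI'. pose proof (omega_empty Hw). auto.
      + intros v Hv. apply HI' in Hv.
        destruct Hv as (_ & _ & [[_ ->]|(n & x & Hs & _)]); [reflexivity|].
        now destruct (succ_not_empty z n).
    - intros n m Hn Hm (x & Hx & Hxu).
      pose proof (proj1 (HI' n x) Hx) as (_ & HxA & _).
      destruct (Hex n x Hn HxA) as (y & Hy & HRy). exists y. split.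
      + apply HI'. splits; [now apply (omega_succ Hw n)|exact Hy|].
        right. now exists n, x.
      + intros v Hv. apply HI' in Hv.
        destruct Hv as (_ & HvA & [[Hz _]|(n' & x' & Hs & Hx' & HRv)]).
        * now destruct (succ_not_empty m n).
        * rewrite (succ_inj m n' n Hs Hm) in *. rewrite <- (Hxu x' Hx') in *.
          now apply (Huniq n x). }
  exists I. split; [split; [|exact Hfun]|split].
  - intros p Hp. now apply HB, HI.
  - intros z Hz. apply HI'. pose proof (omega_empty Hw). auto.
  - intros n m x y Hn Hm Hx Hy. apply HI' in Hy.
    destruct Hy as (_ & HvA & [[Hz _]|(n' & x' & Hs & Hx' & HRv)]).
    + now destruct (succ_not_empty m n).
    + rewrite (succ_inj m n' n Hs Hm) in *.
      destruct (Hfun n Hn) as (x1 & _ & Hu). now rewrite <- (Hu x Hx), (Hu x' Hx').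
Qed.

(* The stages of this closure are not bounded by a known set, so the recursion
   runs over single approximations: a set [f] of pairs, each of which is
   justified by [f] itself. *)
Lemma pairing_closure (w : V) : is_omega w ->
  exists H, subset w H /\
    forall x y p, x ∈ H -> y ∈ H -> is_upair p x y -> p ∈ H.
Proof.
  intros Hw.
  (* The next stage is the union of [x] and its power set: it contains all pairs of elements of [x],
     and keeping [x] makes the stages increase, so that two elements of the union lie in a common
     stage. *)
  set (next := fun x v : V => forall z, z ∈ v <-> z ∈ x \/ subset z x).
  set (justified := fun f k v : V => (is_empty k /\ v = w) \/
     exists n x, is_succ k n /\ related f n x /\ next x v).
  set (approx := fun f : V =>
    forall p, p ∈ f -> exists k v, is_opair p k v /\ justified f k v).
  set (stage := fun n v : V => exists f, approx f /\ related f n v).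
  assert (next_exists : forall x, exists v, next x v).
  { intros x. destruct (ZF_power hZF x) as [P HP].
    destruct (union2_exists x P) as [v Hv]. exists v. intros z.
    now rewrite Hv, HP. }
  assert (next_unique : forall x v v', next x v -> next x v' -> v = v').
  { intros x v v' Hv Hv'. apply (ZF_extensionality hZF). intros z.
    now rewrite (Hv z), (Hv' z). }
  assert (stage_inv : forall k v, stage k v -> (is_empty k /\ v = w) \/
     exists n x, is_succ k n /\ stage n x /\ next x v).
  { intros k v (f & Hf & Hkv). pose proof Hkv as Hp. apply related_iff in Hp.
    destruct (Hf _ Hp) as (k' & v' & Hp' & Hj).
    destruct (is_opair_inj _ _ _ _ _ (opair_spec k v) Hp'). subst k' v'.
    destruct Hj as [Hj|(n & x & Hs & Hx & Hn)]; [auto|]. right.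
    exists n, x. splits; try apply Hn; auto. now exists f. }
  assert (stage_empty : forall k, is_empty k -> stage k w).
  { intros k Hk. destruct (upair_exists (opair k w) (opair k w)) as [f Hf].
    exists f. split; [|apply related_iff, Hf; auto].
    intros p Hp. apply Hf in Hp. exists k, w. split; [|left; auto].
    apply is_opair_iff. tauto. }
  (* Adding the single pair (k, v) to an approximation keeps every older pair justified. *)
  assert (stage_succ : forall k n x v,
    stage n x -> is_succ k n -> next x v -> stage k v).
  { intros k n x v (f & Hf & Hx) Hs Hn.
    destruct (upair_exists (opair k v) (opair k v)) as [s Hsi].
    destruct (union2_exists f s) as [g Hg].
    assert (Hfg : forall a b, related f a b -> related g a b).
    { intros a b. rewrite !related_iff, Hg. auto. }
    exists g. split.
    - intros p Hp. apply Hg in Hp. destruct Hp as [Hp|Hp].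
      + destruct (Hf p Hp) as (k' & v' & Hp' & Hj). exists k', v'.
        split; [exact Hp'|].
        destruct Hj as [Hj|(n' & x' & Hs' & Hx' & Hn')]; [left; auto|right].
        exists n', x'. auto.
      + exists k, v. split; [apply is_opair_iff; apply Hsi in Hp; tauto|].
        right. exists n, x. auto.
    - apply related_iff, Hg. right. apply Hsi. auto. }
  assert (stage_exists : forall n, n ∈ w -> exists v, stage n v).
  { apply (omega_induction Hw).
    - unfold stage, approx, justified, next. solve_definable.
    - eauto.
    - intros n m Hn Hs [x Hx]. destruct (next_exists x) as [v Hv]. eauto. }
  assert (stage_unique : forall n, n ∈ w ->
    forall v v', stage n v -> stage n v' -> v = v').
  { refine (omega_induction Hw
      (fun n => forall v v', stage n v -> stage n v' -> v = v') _ _ _).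
    - unfold stage, approx, justified, next. solve_definable.
    - intros z Hz v v' Hv Hv'. apply stage_inv in Hv, Hv'.
      destruct Hv as [[_ ->]|(n & x & Hs & _)];
        [|now destruct (succ_not_empty z n)].
      destruct Hv' as [[_ ->]|(n & x & Hs & _)];
        [reflexivity|now destruct (succ_not_empty z n)].
    - intros n m Hn Hs IH v v' Hv Hv'. apply stage_inv in Hv, Hv'.
      destruct Hv as [[Hz _]|(n1 & x1 & Hs1 & Hx1 & Hv)];
        [now destruct (succ_not_empty m n)|].
      destruct Hv' as [[Hz _]|(n2 & x2 & Hs2 & Hx2 & Hv')];
        [now destruct (succ_not_empty m n)|].
      rewrite (succ_inj m n1 n Hs1 Hs), (succ_inj m n2 n Hs2 Hs) in *.
      rewrite (IH x2 x1 Hx2 Hx1) in *. eauto. }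
  assert (stage_mono : forall m, m ∈ w -> forall n x y,
    n ∈ m -> stage n x -> stage m y -> subset x y).
  { refine (omega_induction Hw (fun m => forall n x y,
      n ∈ m -> stage n x -> stage m y -> subset x y) _ _ _).
    - unfold stage, approx, justified, next. solve_definable.
    - intros z Hz n x y Hn. now destruct (Hz n).
    - intros k m Hk Hs IH n x y Hn Hx Hy. apply stage_inv in Hy.
      destruct Hy as [[Hz _]|(n1 & x1 & Hs1 & Hx1 & Hv)];
        [now destruct (succ_not_empty m k)|].
      rewrite (succ_inj m n1 k Hs1 Hs) in *.
      apply Hs in Hn. intros z Hz. apply Hv. left. destruct Hn as [Hn| ->].
      + now apply (IH n x x1 Hn).
      + now rewrite <- (stage_unique k Hk x x1 Hx Hx1). }
  destruct (replacement stage w) as [S HS].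
  { unfold stage, approx, justified, next. solve_definable. }
  { intros n Hn v v'. now apply stage_unique. }
  destruct (ZF_union hZF S) as [H HH].
  assert (HH' : forall z, z ∈ H <-> exists n x, n ∈ w /\ stage n x /\ z ∈ x).
  { intros z. rewrite HH. split.
    - intros (x & Hx & Hz). apply HS in Hx. destruct Hx as (n & Hn & Hx).
      now exists n, x.
    - intros (n & x & Hn & Hx & Hz). exists x. split; [|exact Hz].
      apply HS. now exists n. }
  assert (Hclosed : forall n u x y p, n ∈ w -> stage n u -> x ∈ u -> y ∈ u ->
    is_upair p x y -> p ∈ H).
  { intros n u x y p Hn Hu Hx Hy Hp. destruct (next_exists u) as [v Hv].
    destruct (succ_exists n) as [m Hm]. apply HH'. exists m, v.
    split; [now apply (omega_succ Hw n)|]. split; [eauto|]. apply Hv. right.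
    intros z Hz. apply Hp in Hz. destruct Hz; now subst. }
  exists H. split.
  - intros n Hn. apply HH'. destruct (empty_exists w) as [z Hz].
    pose proof (omega_empty Hw z Hz).
    exists z, w. auto.
  - intros x y p Hx Hy Hp. apply HH' in Hx, Hy.
    destruct Hx as (n & u & Hn & Hu & Hx), Hy as (m & v & Hm & Hv & Hy).
    destruct (proj2 (omega_ordinal Hw) n m Hn Hm) as [Hnm|[->|Hnm]].
    + apply (Hclosed m v x y p); auto. now apply (stage_mono m Hm n u v).
    + rewrite (stage_unique m Hm v u) in *; eauto.
    + apply (Hclosed n u x y p); auto. now apply (stage_mono n Hn m v u).
Qed.

(** * Internal formulas *)

Lemma numeral_exists n (x0 : V) : exists x : V, is_numeral n x.
Proof.
  induction n as [|n [y Hy]]; [exact (empty_exists x0)|].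
  destruct (succ_exists y) as [x Hx]. exists x, y. auto.
Qed.

Lemma numeral_unique n : forall x y : V, is_numeral n x -> is_numeral n y -> x = y.
Proof.
  induction n as [|n IH]; intros x y Hx Hy; [exact (empty_unique x y Hx Hy)|].
  destruct Hx as (x' & Hx' & Hx), Hy as (y' & Hy' & Hy).
  rewrite (IH y' x' Hy' Hx') in Hy. exact (succ_unique x y x' Hx Hy).
Qed.

Lemma numeral_inj n : forall m (x : V), is_numeral n x -> is_numeral m x -> n = m.
Proof.
  induction n as [|n IH]; intros [|m] x Hn Hm; trivial.
  - destruct Hm as (y & _ & Hy). now destruct (succ_not_empty x y).
  - destruct Hn as (y & _ & Hy). now destruct (succ_not_empty x y).
  - destruct Hn as (y & Hy & Hxy), Hm as (z & Hz & Hxz). f_equal.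
    apply (IH m y Hy). now rewrite (succ_inj x y z Hxy Hxz).
Qed.

Lemma numeral_mem_omega (w : V) n : is_omega w -> forall x, is_numeral n x -> x ∈ w.
Proof.
  intros Hw. induction n as [|n IH]; intros x Hx; [exact (omega_empty Hw x Hx)|].
  destruct Hx as (y & Hy & Hx). exact (omega_succ Hw y x (IH y Hy) Hx).
Qed.

(** * Codes of formulas and their satisfaction *)

Section Codes.
Context {w : V} (Hw : is_omega w).

Definition num (n : nat) : V := the (is_numeral n) w.

Lemma num_spec n : is_numeral n (num n).
Proof. unfold num, the. apply epsilon_spec, (numeral_exists n w). Qed.

Lemma num_omega n : num n ∈ w.
Proof. exact (numeral_mem_omega w n Hw _ (num_spec n)). Qed.

Lemma num_inj n m : num n = num m -> n = m.
Proof.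
  intros H. apply (numeral_inj n m (num n)); [apply num_spec|].
  rewrite H. apply num_spec.
Qed.

Definition tag (n : nat) (x : V) : V := opair (num n) x.

Lemma tag_inj n m x y : tag n x = tag m y -> n = m /\ x = y.
Proof.
  intros H. destruct (opair_inj _ _ _ _ H). auto using num_inj.
Qed.

Lemma is_tagged_iff n z x : is_tagged n z x <-> z = tag n x.
Proof.
  split.
  - intros (t & Ht & Hz). apply is_opair_iff in Hz.
    now rewrite (numeral_unique n t (num n) Ht (num_spec n)) in Hz.
  - intros ->. exists (num n). split; [apply num_spec|apply opair_spec].
Qed.

Lemma is_tagged2_iff n z x y : is_tagged2 n z x y <-> z = tag n (opair x y).
Proof.
  split.
  - intros (p & Hp & Hz). apply is_opair_iff in Hp. subst. now apply is_tagged_iff.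
  - intros H. exists (opair x y). split; [apply opair_spec|now apply is_tagged_iff].
Qed.

Lemma cst_code_iff t : cst_code t <-> t = tag 1 (num 0).
Proof.
  split.
  - intros (e & He & Ht). apply is_tagged_iff in Ht.
    now rewrite (empty_unique e (num 0) He (num_spec 0)) in Ht.
  - intros H. exists (num 0). split; [apply (num_spec 0)|now apply is_tagged_iff].
Qed.

(** [formula_code] refers to all closed sets, so its extension is a set once one closed set is
    known. Codes are iterated pairs over elements of omega, so a superset of omega closed under
    pairing is one. *)
Lemma formula_codes_exist : exists F, forall z, z ∈ F <-> formula_code w z.
Proof.
  destruct (pairing_closure w Hw) as (H & HwH & HH).
  assert (Hop : forall x y, x ∈ H -> y ∈ H -> opair x y ∈ H).
  { intros x y Hx Hy. destruct (opair_spec x y) as (u & v & Hu & Hv & Hp).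
    apply (HH u v); [apply (HH x x)|apply (HH x y)|]; auto. }
  assert (Htag : forall n x, x ∈ H -> tag n x ∈ H).
  { intros n x Hx. apply Hop; auto using num_omega. }
  assert (Hterm : forall t, term_code w t -> t ∈ H).
  { intros t [(i & Hi & Ht)|Ht].
    - apply is_tagged_iff in Ht. subst. auto.
    - apply cst_code_iff in Ht. subst. auto using num_omega. }
  assert (Hcl : formula_closed w H).
  { split; [|split; [|split]].
    - intros s t z Hs Ht [Hz|Hz]; apply is_tagged2_iff in Hz; subst; auto.
    - intros x z Hx Hz; apply is_tagged_iff in Hz; subst; auto.
    - intros x y z Hx Hy Hz; apply is_tagged2_iff in Hz; subst; auto.
    - intros i x z Hi Hx Hz; apply is_tagged2_iff in Hz; subst; auto. }
  destruct (separation (formula_code w) H) as [F HF]; [solve_definable|].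
  exists F. intros z. rewrite HF. split; [tauto|]. intros Hz. split; [|exact Hz].
  now apply Hz.
Qed.

Lemma formula_code_atom s t z : term_code w s -> term_code w t ->
  mem_code z s t \/ eq_code z s t -> formula_code w z.
Proof. intros Hs Ht Hz X HX. exact (proj1 HX s t z Hs Ht Hz). Qed.

Lemma formula_code_not x z : formula_code w x -> not_code z x -> formula_code w z.
Proof. intros Hx Hz X HX. apply (proj1 (proj2 HX) x z); auto. Qed.

Lemma formula_code_and x y z : formula_code w x -> formula_code w y ->
  and_code z x y -> formula_code w z.
Proof. intros Hx Hy Hz X HX. apply (proj1 (proj2 (proj2 HX)) x y z); auto. Qed.

Lemma formula_code_ex i x z : i ∈ w -> formula_code w x -> ex_code z i x ->
  formula_code w z.
Proof. intros Hi Hx Hz X HX. apply (proj2 (proj2 (proj2 HX)) i x z); auto. Qed.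

(** Induction inside the model, for definable [Q]; it reaches also the codes that a nonstandard
    omega adds. *)
Lemma formula_code_induction (Q : V -> Prop) : definable (fun e => Q (e 0)) ->
  (forall s t z, term_code w s -> term_code w t ->
     mem_code z s t \/ eq_code z s t -> Q z) ->
  (forall x z, formula_code w x -> Q x -> not_code z x -> Q z) ->
  (forall x y z, formula_code w x -> Q x -> formula_code w y -> Q y ->
     and_code z x y -> Q z) ->
  (forall i x z, i ∈ w -> formula_code w x -> Q x -> ex_code z i x -> Q z) ->
  forall z, formula_code w z -> Q z.
Proof.
  intros HQ Hat Hnot Hand Hex z Hz.
  destruct formula_codes_exist as [F HF].
  destruct (separation Q F HQ) as [X HX]. apply HX, Hz. split; [|split; [|split]].
  - intros s t u Hs Ht Hu. apply HX. rewrite HF.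
    split; [apply (formula_code_atom s t)|apply (Hat s t)]; auto.
  - intros x u Hx Hu. apply HX in Hx. apply HX. rewrite HF in *.
    split; [apply (formula_code_not x)|apply (Hnot x)]; tauto.
  - intros x y u Hx Hy Hu. apply HX in Hx, Hy. apply HX. rewrite HF in *.
    split; [apply (formula_code_and x y)|apply (Hand x y)]; tauto.
  - intros i x u Hi Hx Hu. apply HX in Hx. apply HX. rewrite HF in *.
    split; [apply (formula_code_ex i x)|apply (Hex i x)]; tauto.
Qed.

(** Code relations become equations between tagged pairs. The tags are numbers of the metatheory, so
    distinct ones are refuted by [discriminate]. *)
Ltac decode :=
  repeat match goal with
  | H : mem_code _ _ _ |- _ => apply is_tagged2_iff in H
  | H : eq_code _ _ _ |- _ => apply is_tagged2_iff in H
  | H : not_code _ _ |- _ => apply is_tagged_iff in H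
  | H : and_code _ _ _ |- _ => apply is_tagged2_iff in H
  | H : ex_code _ _ _ |- _ => apply is_tagged2_iff in H
  | H : var_code _ _ |- _ => apply is_tagged_iff in H
  | H : cst_code _ |- _ => apply cst_code_iff in H
  end;
  subst;
  repeat match goal with
  | H : tag _ _ = tag _ _ |- _ => apply tag_inj in H as [? ?]; try discriminate
  | H : opair _ _ = opair _ _ |- _ => apply opair_inj in H as [? ?]
  end;
  subst.

(* The value of a formula is the set of assignments satisfying it, so negation
   is not an obstacle to reading Tarski's clauses as a monotone operator on
   sets of pairs (formula, value). *)
Lemma satisfaction_exists (N c : V) : exists S, satisfaction w N c S.
Proof.
  destruct formula_codes_exist as [F HF].
  destruct (product_exists w N) as [WN HWN]. destruct (ZF_power hZF WN) as [PWN HPWN].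
  destruct (separation (fun a => is_function a w N) PWN) as [A HA'];
    [solve_definable|].
  assert (HA : forall a, a ∈ A <-> is_function a w N).
  { intros a. rewrite HA'. split; [tauto|]. intros Ha. split; [|exact Ha].
    apply HPWN. intros p Hp. now apply HWN, (proj1 Ha). }
  clear HA' PWN HPWN WN HWN.
  destruct (ZF_power hZF A) as [PA HPA].
  destruct (product_exists F PA) as [B HB].
  set (rule := fun X z s : V =>
    (exists t u, term_code w t /\ term_code w u /\ mem_code z t u /\
       forall a, a ∈ A ->
         (a ∈ s <-> exists x y, value c a t x /\ value c a u y /\ x ∈ y)) \/
    (exists t u, term_code w t /\ term_code w u /\ eq_code z t u /\
       forall a, a ∈ A ->
         (a ∈ s <-> exists x y, value c a t x /\ value c a u y /\ x = y)) \/
    (exists x s', not_code z x /\ related X x s' /\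
       forall a, a ∈ A -> (a ∈ s <-> ~ a ∈ s')) \/
    (exists x y s1 s2, and_code z x y /\ related X x s1 /\ related X y s2 /\
       forall a, a ∈ A -> (a ∈ s <-> a ∈ s1 /\ a ∈ s2)) \/
    (exists i x s', i ∈ w /\ ex_code z i x /\ related X x s' /\
       forall a, a ∈ A ->
         (a ∈ s <-> exists b, b ∈ A /\ agree_off w i a b /\ b ∈ s'))).
  destruct (fixpoint_exists B
    (fun X p => exists z s, is_opair p z s /\ rule X z s)) as [I HI].
  { unfold rule. solve_definable. }
  { intros X Y p HXY (z & s & Hp & H). exists z, s. split; [exact Hp|].
    assert (HR : forall x y, related X x y -> related Y x y).
    { intros x y. rewrite !related_iff. apply HXY. }
    destruct H as [H|[H|[H|[H|H]]]]; [left; exact H|right; left; exact H| | |];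
      right; right.
    - left. destruct H as (x & s' & H). exists x, s'. intuition.
    - right; left. destruct H as (x & y & s1 & s2 & H). exists x, y, s1, s2. intuition.
    - right; right. destruct H as (i & x & s' & H). exists i, x, s'. intuition. }
  assert (HI' : forall z s, related I z s <->
    formula_code w z /\ subset s A /\ rule I z s).
  { intros z s. rewrite related_iff, HI, HB, <- HF, <- HPA. split.
    - intros [(z' & s' & Hz & Hs & Hp) (z1 & s1 & Hp' & H)].
      destruct (is_opair_inj _ _ _ _ _ (opair_spec z s) Hp).
      destruct (is_opair_inj _ _ _ _ _ (opair_spec z s) Hp'). subst. auto.
    - intros (Hz & Hs & H). split; exists z, s; auto using opair_spec. }
  clear HI HB HPA B PA.
  assert (Hext : forall s s' (G : V -> Prop), subset s A -> subset s' A ->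
    (forall a, a ∈ A -> (a ∈ s <-> G a)) -> (forall a, a ∈ A -> (a ∈ s' <-> G a)) ->
    s = s').
  { intros s s' G Hs Hs' H H'. apply (ZF_extensionality hZF). intros a.
    split; intros Ha; [apply H'|apply H]; auto; [apply H|apply H']; auto. }
  (* Unique readability: the tag of [z] leaves one clause of [rule], and [decode] discards the
     others. The same holds for the next four inversions. *)
  assert (inv_mem : forall t u z s, mem_code z t u -> related I z s ->
    forall a, a ∈ A ->
      (a ∈ s <-> exists x y, value c a t x /\ value c a u y /\ x ∈ y)).
  { intros t u z s Hz Hs. apply HI' in Hs. destruct Hs as (_ & _ & Hr).
    destruct Hr as [Hr|[Hr|[Hr|[Hr|Hr]]]]; decompose record Hr; decode; auto. }
  assert (inv_eq : forall t u z s, eq_code z t u -> related I z s ->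
    forall a, a ∈ A ->
      (a ∈ s <-> exists x y, value c a t x /\ value c a u y /\ x = y)).
  { intros t u z s Hz Hs. apply HI' in Hs. destruct Hs as (_ & _ & Hr).
    destruct Hr as [Hr|[Hr|[Hr|[Hr|Hr]]]]; decompose record Hr; decode; auto. }
  assert (inv_not : forall x z s, not_code z x -> related I z s ->
    exists s', related I x s' /\ forall a, a ∈ A -> (a ∈ s <-> ~ a ∈ s')).
  { intros x z s Hz Hs. apply HI' in Hs. destruct Hs as (_ & _ & Hr).
    destruct Hr as [Hr|[Hr|[Hr|[Hr|Hr]]]]; decompose record Hr; decode; eauto. }
  assert (inv_and : forall x y z s, and_code z x y -> related I z s ->
    exists s1 s2, related I x s1 /\ related I y s2 /\
      forall a, a ∈ A -> (a ∈ s <-> a ∈ s1 /\ a ∈ s2)).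
  { intros x y z s Hz Hs. apply HI' in Hs. destruct Hs as (_ & _ & Hr).
    destruct Hr as [Hr|[Hr|[Hr|[Hr|Hr]]]]; decompose record Hr; decode; eauto. }
  assert (inv_ex : forall i x z s, ex_code z i x -> related I z s ->
    exists s', related I x s' /\ forall a, a ∈ A ->
      (a ∈ s <-> exists b, b ∈ A /\ agree_off w i a b /\ b ∈ s')).
  { intros i x z s Hz Hs. apply HI' in Hs. destruct Hs as (_ & _ & Hr).
    destruct Hr as [Hr|[Hr|[Hr|[Hr|Hr]]]]; decompose record Hr; decode; eauto. }
  assert (Hsub : forall z s, related I z s -> subset s A).
  { intros z s Hs. now apply HI' in Hs. }
  assert (Huniq : forall z, formula_code w z -> forall s s',
    related I z s -> related I z s' -> s = s').
  { refine (formula_code_induction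
      (fun z => forall s s', related I z s -> related I z s' -> s = s') _ _ _ _ _).
    - solve_definable.
    - intros t u z Ht Hu [Hz|Hz] s s' Hs Hs'.
      + exact (Hext s s' _ (Hsub z s Hs) (Hsub z s' Hs')
          (inv_mem t u z s Hz Hs) (inv_mem t u z s' Hz Hs')).
      + exact (Hext s s' _ (Hsub z s Hs) (Hsub z s' Hs')
          (inv_eq t u z s Hz Hs) (inv_eq t u z s' Hz Hs')).
    - intros x z Hx IH Hz s s' Hs Hs'.
      destruct (inv_not x z s Hz Hs) as (t & Ht & H).
      destruct (inv_not x z s' Hz Hs') as (t' & Ht' & H').
      rewrite (IH t' t Ht' Ht) in H'.
      exact (Hext s s' _ (Hsub z s Hs) (Hsub z s' Hs') H H').
    - intros x y z Hx IHx Hy IHy Hz s s' Hs Hs'.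
      destruct (inv_and x y z s Hz Hs) as (t & u & Ht & Hu & H).
      destruct (inv_and x y z s' Hz Hs') as (t' & u' & Ht' & Hu' & H').
      rewrite (IHx t' t Ht' Ht), (IHy u' u Hu' Hu) in H'.
      exact (Hext s s' _ (Hsub z s Hs) (Hsub z s' Hs') H H').
    - intros i x z Hi Hx IH Hz s s' Hs Hs'.
      destruct (inv_ex i x z s Hz Hs) as (t & Ht & H).
      destruct (inv_ex i x z s' Hz Hs') as (t' & Ht' & H').
      rewrite (IH t' t Ht' Ht) in H'.
      exact (Hext s s' _ (Hsub z s Hs) (Hsub z s' Hs') H H'). }
  assert (Hexist : forall z, formula_code w z -> exists s, related I z s).
  (* Separation turns the right-hand side of a Tarski clause into a value, which the matching clause
     of [rule] accepts. *)
  { assert (Hmake : forall (z : V) (G : V -> Prop), formula_code w z ->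
      definable (fun e => G (e 0)) ->
      (forall s, (forall a, a ∈ A -> (a ∈ s <-> G a)) -> rule I z s) ->
      exists s, related I z s).
    { intros z G Hz HG H. destruct (separation G A HG) as [s Hs]. exists s.
      apply HI'. split; [exact Hz|split; [intros a Ha; now apply Hs|]].
      apply H. intros a Ha. rewrite Hs. tauto. }
    apply formula_code_induction.
    - solve_definable.
    - intros t u z Ht Hu Hz.
      pose proof (formula_code_atom t u z Ht Hu Hz) as Hzc. destruct Hz as [Hz|Hz].
      + apply (Hmake z (fun a =>
          exists x y, value c a t x /\ value c a u y /\ x ∈ y)); trivial.
        * solve_definable.
        * intros s Hs. left. eauto 8.
      + apply (Hmake z (fun a =>
          exists x y, value c a t x /\ value c a u y /\ x = y)); trivial.
        * solve_definable.
        * intros s Hs. right; left. eauto 8.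
    - intros x z Hx [t Ht] Hz.
      apply (Hmake z (fun a => ~ a ∈ t)); [now apply (formula_code_not x)| |].
      + solve_definable.
      + intros s Hs. right; right; left. eauto.
    - intros x y z Hx [t Ht] Hy [u Hu] Hz.
      apply (Hmake z (fun a => a ∈ t /\ a ∈ u)); [now apply (formula_code_and x y)| |].
      + solve_definable.
      + intros s Hs. right; right; right; left. eauto 9.
    - intros i x z Hi Hx [t Ht] Hz.
      apply (Hmake z (fun a => exists b, b ∈ A /\ agree_off w i a b /\ b ∈ t));
        [now apply (formula_code_ex i x)| |].
      + solve_definable.
      + intros s Hs. right; right; right; right. eauto 8. }
  destruct (relation_exists F A (fun z a => exists s, related I z s /\ a ∈ s))
    as (S & _ & HS); [solve_definable|].
  assert (HSval : forall z s a, related I z s -> a ∈ A ->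
    (related S z a <-> a ∈ s)).
  { intros z s a Hs Ha. pose proof Hs as Hz. apply HI' in Hz as [Hz _].
    rewrite HS, HF. split.
    - intros (_ & _ & s' & Hs' & Has). now rewrite (Huniq z Hz s s').
    - eauto. }
  exists S. intros a Ha. apply HA in Ha. splits.
  - intros t u z Ht Hu Hz.
    destruct (Hexist z) as [s Hs]; [now apply (formula_code_atom t u); auto|].
    rewrite (HSval z s a Hs Ha). eauto.
  - intros t u z Ht Hu Hz.
    destruct (Hexist z) as [s Hs]; [now apply (formula_code_atom t u); auto|].
    rewrite (HSval z s a Hs Ha). eauto.
  - intros x z Hx Hz.
    destruct (Hexist z) as [s Hs]; [now apply (formula_code_not x)|].
    destruct (inv_not x z s Hz Hs) as (t & Ht & H).
    rewrite (HSval z s a Hs Ha), (HSval x t a Ht Ha). auto.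
  - intros x y z Hx Hy Hz.
    destruct (Hexist z) as [s Hs]; [now apply (formula_code_and x y)|].
    destruct (inv_and x y z s Hz Hs) as (t & u & Ht & Hu & H).
    rewrite (HSval z s a Hs Ha), (HSval x t a Ht Ha), (HSval y u a Hu Ha). auto.
  - intros i x z Hi Hx Hz.
    destruct (Hexist z) as [s Hs]; [now apply (formula_code_ex i x)|].
    destruct (inv_ex i x z s Hz Hs) as (t & Ht & H).
    rewrite (HSval z s a Hs Ha), (H a Ha).
    split; intros (b & Hb & Hab & Hbt); exists b;
      [apply HA in Hb as Hb'|apply HA in Hb]; splits; trivial;
      now apply (HSval x t b Ht).
Qed.


(** * Elementary submodels *)

(** Formulas of the metatheory in the language of the internal codes; variables are named because
    the internal quantifier names its variable. Their codes are the standard ones. *)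
Inductive mterm : Type := MVar (n : nat) | MCst.

Inductive mformula : Type :=
| MMem (s t : mterm)
| MEq (s t : mterm)
| MNot (phi : mformula)
| MAnd (phi psi : mformula)
| MEx (n : nat) (phi : mformula).

Definition update (v : nat -> V) (n : nat) (x : V) (m : nat) : V :=
  if m =? n then x else v m.

Definition mval (c : V) (v : nat -> V) (t : mterm) : V :=
  match t with MVar n => v n | MCst => c end.

Fixpoint msat (N c : V) (v : nat -> V) (phi : mformula) : Prop :=
  match phi with
  | MMem s t => mval c v s ∈ mval c v t
  | MEq s t => mval c v s = mval c v t
  | MNot phi => ~ msat N c v phi
  | MAnd phi psi => msat N c v phi /\ msat N c v psi
  | MEx n phi => exists x, x ∈ N /\ msat N c (update v n x) phi
  end.

Definition tcode (t : mterm) : V :=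
  match t with MVar n => tag 0 (num n) | MCst => tag 1 (num 0) end.

Fixpoint code (phi : mformula) : V :=
  match phi with
  | MMem s t => tag 0 (opair (tcode s) (tcode t))
  | MEq s t => tag 1 (opair (tcode s) (tcode t))
  | MNot phi => tag 2 (code phi)
  | MAnd phi psi => tag 3 (opair (code phi) (code psi))
  | MEx n phi => tag 4 (opair (num n) (code phi))
  end.

Lemma msat_ext N c phi : forall v v', (forall n, v n = v' n) ->
  (msat N c v phi <-> msat N c v' phi).
Proof.
  assert (Ht : forall v v' t, (forall n, v n = v' n) -> mval c v t = mval c v' t).
  { intros v v' [n|] H; simpl; auto. }
  induction phi as [s t|s t|phi IH|phi IH psi IH'|n phi IH]; intros v v' H; simpl.
  - now rewrite (Ht v v' s H), (Ht v v' t H).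
  - now rewrite (Ht v v' s H), (Ht v v' t H).
  - now rewrite (IH v v' H).
  - now rewrite (IH v v' H), (IH' v v' H).
  - assert (Hu : forall x m, update v n x m = update v' n x m).
    { intros x m. unfold update. now destruct (m =? n). }
    split; intros (x & Hx & Hs); exists x; split; trivial;
      now apply (IH _ _ (Hu x)).
Qed.

Lemma tcode_term t : term_code w (tcode t).
Proof.
  destruct t as [n|]; [left|right].
  - exists (num n). split; [apply num_omega|now apply is_tagged_iff].
  - now apply cst_code_iff.
Qed.

Lemma code_formula phi : formula_code w (code phi).
Proof.
  induction phi as [s t|s t|phi IH|phi IH psi IH'|n phi IH]; simpl.
  - apply (formula_code_atom (tcode s) (tcode t)); try apply tcode_term.
    left. now apply is_tagged2_iff.
  - apply (formula_code_atom (tcode s) (tcode t)); try apply tcode_term.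
    right. now apply is_tagged2_iff.
  - apply (formula_code_not (code phi)); [exact IH|now apply is_tagged_iff].
  - apply (formula_code_and (code phi) (code psi)); trivial.
    now apply is_tagged2_iff.
  - apply (formula_code_ex (num n) (code phi)); trivial; [apply num_omega|].
    now apply is_tagged2_iff.
Qed.

Definition assign (a : V) (n : nat) : V := the (related a (num n)) w.

Lemma assign_iff (a N : V) n x : is_function a w N ->
  related a (num n) x <-> x = assign a n.
Proof.
  intros Ha.
  assert (H : related a (num n) (assign a n)).
  { apply (epsilon_spec (inhabits w) (related a (num n))), (function_total Ha).
    apply num_omega. }
  split; [|now intros ->]. intros Hx. exact (function_unique Ha _ _ _ Hx H).
Qed.

Lemma assign_mem (a N : V) n : is_function a w N -> assign a n ∈ N.
Proof.
  intros Ha. apply (function_cod Ha (num n)). now apply (assign_iff a N).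
Qed.

Lemma function_update (a N i x : V) : is_function a w N -> i ∈ w -> x ∈ N ->
  exists b, is_function b w N /\ related b i x /\ agree_off w i a b.
Proof.
  intros Ha Hi Hx.
  destruct (function_exists w N
    (fun j y => (j = i /\ y = x) \/ (j <> i /\ related a j y))) as (b & Hb & H).
  - solve_definable.
  - intros j Hj. destruct (classic (j = i)) as [->|Hne].
    + exists x. auto.
    + destruct (function_total Ha j Hj) as [y Hy]. exists y.
      pose proof (function_cod Ha j y Hy). auto.
  - intros j y y' _ _ _ [[-> ->]|[Hj Hy]] [[Hj' ->]|[Hj' Hy']]; try tauto.
    exact (function_unique Ha j y y' Hy Hy').
  - exists b. split; [exact Hb|split].
    + apply H. auto.
    + intros j y Hj Hne. rewrite H. split; [|tauto].
      intros Hy. pose proof (function_cod Ha j y Hy). auto.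
Qed.

Lemma agree_off_assign (a b N : V) n x : is_function a w N -> is_function b w N ->
  agree_off w (num n) a b -> related b (num n) x ->
  forall m, assign b m = update (assign a) n x m.
Proof.
  intros Ha Hb Hab Hx m. symmetry. apply (assign_iff b N m _ Hb). unfold update.
  destruct (Nat.eqb_spec m n) as [->|Hne]; [exact Hx|].
  apply Hab; [apply num_omega|intros H; now apply Hne, num_inj|].
  now apply (assign_iff a N).
Qed.

(** Tarski's clauses fix the truth value of each standard code, by induction over the formula of the
    metatheory, so all satisfaction relations agree there. *)
Lemma satisfaction_msat (N c S : V) phi : satisfaction w N c S ->
  forall a, is_function a w N ->
  (related S (code phi) a <-> msat N c (assign a) phi).
Proof.
  intros HS.
  assert (Hval : forall a t x, is_function a w N ->
    (value c a (tcode t) x <-> x = mval c (assign a) t)).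
  { intros a [n|] x Ha; simpl; unfold value.
    - split.
      + intros [(i & Hi & Hx)|[H _]]; decode. now apply (assign_iff a N).
      + intros H. left. exists (num n).
        split; [now apply is_tagged_iff|now apply (assign_iff a N)].
    - split; [intros [(i & Hi & Hx)|[_ H]]; decode; trivial|].
      intros H. right. split; [now apply cst_code_iff|exact H]. }
  induction phi as [s t|s t|phi IH|phi IH psi IH'|n phi IH]; intros a Ha; simpl;
    destruct (HS a Ha) as (Hm & He & Hn & Hd & Hx).
  - rewrite (Hm (tcode s) (tcode t)); try apply tcode_term;
      [|now apply is_tagged2_iff].
    split.
    + intros (x & y & Hx' & Hy & H). apply Hval in Hx', Hy; trivial. now subst.
    + intros H. do 2 eexists. split; [now apply Hval|split; [now apply Hval|exact H]].
  - rewrite (He (tcode s) (tcode t)); try apply tcode_term;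
      [|now apply is_tagged2_iff].
    split.
    + intros (x & y & Hx' & Hy & H). apply Hval in Hx', Hy; trivial. now subst.
    + intros H. do 2 eexists. split; [now apply Hval|split; [now apply Hval|exact H]].
  - rewrite (Hn (code phi)), IH; [reflexivity|exact Ha|apply code_formula|].
    now apply is_tagged_iff.
  - rewrite (Hd (code phi) (code psi)), IH, IH';
      [reflexivity|exact Ha|exact Ha|apply code_formula|apply code_formula|].
    now apply is_tagged2_iff.
  - rewrite (Hx (num n) (code phi));
      [|apply num_omega|apply code_formula|now apply is_tagged2_iff].
    split.
    + intros (b & Hb & Hab & H). exists (assign b n).
      split; [exact (assign_mem b N n Hb)|]. apply (IH b Hb) in H.
      refine (proj1 (msat_ext _ _ _ _ _ _) H).
      apply (agree_off_assign a b N); trivial. now apply (assign_iff b N).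
    + intros (x & HxN & H).
      destruct (function_update a N (num n) x Ha (num_omega n) HxN)
        as (b & Hb & Hbx & Hab).
      exists b. splits; trivial. apply (IH b Hb).
      refine (proj2 (msat_ext _ _ _ _ _ _) H).
      now apply (agree_off_assign a b N).
Qed.

(** From right to left a satisfaction relation must be exhibited; this is where
    [satisfaction_exists] enters. *)
Lemma models_msat (N c : V) phi a : is_function a w N ->
  (models w N c (code phi) a <-> msat N c (assign a) phi).
Proof.
  intros Ha. split.
  - intros (S & HS & H). now apply (satisfaction_msat N c S phi HS a Ha).
  - intros H. destruct (satisfaction_exists N c) as [S HS]. exists S.
    split; [exact HS|]. now apply (satisfaction_msat N c S phi HS a Ha).
Qed.

(** One half of the Tarski-Vaught criterion: elementarity brings the existential formula down to
    [M], and a second use, for [phi] itself, returns the witness found there to [N]. *)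
Lemma elementary_witness (M N c p q : V) phi :
  elementary M N c -> p ∈ M -> q ∈ M ->
  let v := fun x n => match n with 0 => x | 1 => p | _ => q end in
  (exists x, x ∈ N /\ msat N c (v x) phi) ->
  exists x, x ∈ M /\ msat N c (v x) phi.
Proof.
  intros (Hc & HMN & Hel) Hp Hq v (x & Hx & H).
  (* An internal assignment is defined on all of omega: it takes the value [q] by default and [p] at
     1, and the quantifier overwrites the value at 0. *)
  destruct (function_exists w M (fun _ y => y = q)) as (a0 & Ha0 & Hv0).
  { solve_definable. }
  { eauto. }
  { intros. congruence. }
  destruct (function_update a0 M (num 1) p Ha0 (num_omega 1) Hp)
    as (a & Ha & Hap & Haq).
  assert (Hupd : forall y n, update (assign a) 0 y n = v y n).
  { intros y [|[|n]]; unfold update; simpl; trivial;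
      symmetry; apply (assign_iff a M _ _ Ha); trivial.
    apply Haq; [apply num_omega|intros Heq; apply num_inj in Heq; lia|].
    apply Hv0. auto using num_omega. }
  assert (HaN : is_function a w N) by exact (function_mono _ _ _ _ Ha HMN).
  assert (HM : models w M c (code (MEx 0 phi)) a).
  { apply (Hel w Hw _ _ (code_formula _) Ha), models_msat; [exact HaN|].
    exists x. split; [exact Hx|]. now apply (msat_ext _ _ _ _ _ (Hupd x)). }
  apply models_msat in HM; [|exact Ha]. destruct HM as (y & Hy & HM).
  exists y. split; [exact Hy|].
  destruct (function_update a M (num 0) y Ha (num_omega 0) Hy)
    as (b & Hb & Hby & Hab).
  pose proof (agree_off_assign a b M 0 y Ha Hb Hab Hby) as Hbv.
  apply (msat_ext _ _ _ _ _ (Hupd y)).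
  apply (msat_ext _ _ _ _ _ Hbv).
  apply models_msat; [exact (function_mono _ _ _ _ Hb HMN)|].
  apply (Hel w Hw _ _ (code_formula _) Hb). apply models_msat; [exact Hb|].
  now apply (msat_ext _ _ _ _ _ Hbv).
Qed.

(* In a transitive structure this existential form is equivalent to
   [is_upair p x y]; [k] is a variable not occurring in [p], [x], [y]. *)
Definition m_upair (k : nat) (p x y : mterm) : mformula :=
  MAnd (MAnd (MMem x p) (MMem y p))
    (MNot (MEx k (MAnd (MMem (MVar k) p)
      (MAnd (MNot (MEq (MVar k) x)) (MNot (MEq (MVar k) y)))))).

(** It binds the variables [k], [k + 1] and [k + 2], which therefore must not occur in [p], [x],
    [y]. *)
Definition m_opair (k : nat) (p x y : mterm) : mformula :=
  MEx k (MEx (k + 1)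
    (MAnd (m_upair (k + 2) (MVar k) x x)
      (MAnd (m_upair (k + 2) (MVar (k + 1)) x y)
        (m_upair (k + 2) p (MVar k) (MVar (k + 1)))))).

(* The constant is interpreted by the poset (P, L), the variables 0 and 1 by
   the two conditions. *)
Definition m_strictly : mformula :=
  MAnd (MNot (MEq (MVar 0) (MVar 1)))
    (MEx 2 (MEx 3 (MEx 4
      (MAnd (m_opair 5 MCst (MVar 2) (MVar 3))
        (MAnd (MMem (MVar 4) (MVar 3)) (m_opair 5 (MVar 4) (MVar 0) (MVar 1))))))).

Lemma upair_absolute (N p x y : V) : transitive N -> p ∈ N ->
  (((x ∈ p /\ y ∈ p) /\ ~ exists z, z ∈ N /\ z ∈ p /\ z <> x /\ z <> y)
   <-> is_upair p x y).
Proof.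
  intros HN Hp. split.
  - intros [[Hx Hy] H] z. split; [|intros [-> | ->]; trivial].
    intros Hz. apply NNPP. intros Hn. apply H. exists z.
    split; [now apply (HN p)|]. tauto.
  - intros H. split; [split; apply H; auto|].
    intros (z & _ & Hz & Hzx & Hzy). apply H in Hz. tauto.
Qed.

Lemma opair_components (N p x y u v : V) : transitive N -> p ∈ N ->
  is_upair u x x -> is_upair v x y -> is_upair p u v ->
  u ∈ N /\ v ∈ N /\ x ∈ N /\ y ∈ N.
Proof.
  intros HN Hp Hu Hv Hpuv.
  assert (HuN : u ∈ N) by (apply (HN p Hp), Hpuv; auto).
  assert (HvN : v ∈ N) by (apply (HN p Hp), Hpuv; auto).
  splits; trivial; apply (HN v HvN), Hv; auto.
Qed.

(** All witnesses, from [P] and [L] to the components of the pairs, lie in the transitive closure of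
    [Q], hence in [N]. *)
Lemma m_strictly_correct (N Q P L x y z : V) : transitive N -> Q ∈ N ->
  is_opair Q P L ->
  (msat N Q (fun n => match n with 0 => x | 1 => y | _ => z end) m_strictly <->
   strictly L x y).
Proof.
  intros HN HQ HQPL.
  cbn -[is_upair]. split.
  - intros (Hne & P' & HP' & L' & HL' & p & Hp &
      (u & Hu & v & Hv & H1 & H2 & H3) & HpL &
      (u' & Hu' & v' & Hv' & H1' & H2' & H3')).
    apply upair_absolute in H1, H2, H3, H1', H2', H3'; trivial.
    destruct (is_opair_inj Q P L P' L') as [_ ->]; trivial.
    { now exists u, v. }
    split; [|exact Hne]. exists p. split; [now exists u', v'|exact HpL].
  - intros [(p & (u & v & Hu & Hv & Hp) & HpL) Hne]. split; [exact Hne|].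
    destruct HQPL as (u' & v' & Hu' & Hv' & HQ').
    destruct (opair_components N Q P L u' v') as (Hu'N & Hv'N & HPN & HLN); trivial.
    assert (HpN : p ∈ N) by now apply (HN L).
    destruct (opair_components N p x y u v) as (HuN & HvN & _ & _); trivial.
    exists P. split; [exact HPN|]. exists L. split; [exact HLN|].
    exists p. split; [exact HpN|]. split; [|split; [exact HpL|]].
    + exists u'. split; [exact Hu'N|]. exists v'. split; [exact Hv'N|].
      split; [|split]; now apply upair_absolute.
    + exists u. split; [exact HuN|]. exists v. split; [exact HvN|].
      split; [|split]; now apply upair_absolute.
Qed.

End Codes.

(** * Closed posets are proper *)

Lemma tcl_exists (t x : V) : subset x t -> transitive t -> exists u, is_tcl u x.
Proof.
  intros Hxt Ht.
  destruct (separation (fun z => forall y, subset x y -> transitive y -> z ∈ y) t)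
    as [u Hu]; [solve_definable|].
  exists u. split; [|split].
  - intros z Hz. apply Hu. split; [now apply Hxt|]. intros y Hy _. now apply Hy.
  - intros y Hy z Hz. apply Hu in Hy. destruct Hy as [Hyt Hy]. apply Hu.
    split; [now apply (Ht y)|]. intros y' Hy' Hty'. apply (Hty' y); auto.
  - intros y Hy Hty z Hz. apply Hu in Hz. now apply Hz.
Qed.

(** The surjection is extended to [y] by a constant value [z0] outside [x]. *)
Lemma le_star_subset (k x y : V) : le_star k x -> subset x y -> le_star k y.
Proof.
  intros [He|(f & Hf & Hon)] Hxy; [now left|].
  destruct (classic (is_empty k)) as [He|Hne]; [now left|right].
  assert (Hk : exists z, z ∈ k).
  { apply NNPP. intros H. apply Hne. intros z Hz. eauto. }
  destruct Hk as [z0 Hz0].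
  destruct (function_exists y k (fun a z =>
    related f a z \/ (~ a ∈ x /\ z = z0))) as (g & Hg & H).
  - solve_definable.
  - intros a _. destruct (classic (a ∈ x)) as [Ha|Ha]; [|eauto].
    destruct (function_total Hf a Ha) as [z Hz]. exists z.
    pose proof (function_cod Hf a z Hz). auto.
  - intros a z z' _ _ _ [Hz|[Ha ->]] [Hz'|[Ha' ->]]; trivial.
    + exact (function_unique Hf a z z' Hz Hz').
    + now destruct Ha'; apply (function_dom Hf a z).
    + now destruct Ha; apply (function_dom Hf a z').
  - exists g. split; [exact Hg|]. intros z Hz. destruct (Hon z Hz) as [a Ha].
    exists a. apply H. pose proof (function_dom Hf a z Ha). auto.
Qed.

(** For [z] in [y] the transitive closure of [z] is contained in that of [y]. Transitivity is what
    makes [m_strictly] absolute between [h] and the model. *)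
Lemma H_transitive (h k : V) : is_H h k -> transitive h.
Proof.
  intros Hh y Hy z Hz. apply Hh in Hy. destruct Hy as (t & (Hyt & Ht & _) & Hk).
  assert (Hzt : subset z t) by now apply (Ht z), Hyt.
  destruct (tcl_exists t z Hzt Ht) as [u Hu]. apply Hh. exists u.
  split; [exact Hu|]. intros Hle. apply Hk, (le_star_subset k u t Hle).
  now apply (proj2 (proj2 Hu)).
Qed.

Lemma omega_least (w A g : V) (G : V -> Prop) : is_function g A w ->
  definable (fun e => G (e 0)) -> (exists y, y ∈ A /\ G y) ->
  exists y, y ∈ A /\ G y /\
    forall y' i i', G y' -> related g y i -> related g y' i' -> ~ i' ∈ i.
Proof.
  intros Hg HG (y & HyA & Hy).
  destruct (separation (fun i => exists y, related g y i /\ G y) w) as [I HI];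
    [solve_definable|].
  destruct (function_total Hg y HyA) as [i Hi].
  destruct (@ZF_foundation V hZF I) as (j & Hj & Hmin).
  { exists i. apply HI. pose proof (function_cod Hg y i Hi). eauto. }
  apply HI in Hj. destruct Hj as (Hjw & x & Hx & HGx). exists x.
  pose proof (function_dom Hg x j Hx). splits; trivial.
  intros y' k i' HGy' Hk Hi'. rewrite (function_unique Hg x k j Hk Hx).
  apply Hmin, HI. pose proof (function_cod Hg y' i' Hi'). eauto.
Qed.

Lemma strictly_trans (P L x y z : V) : partial_order P L ->
  strictly L x y -> strictly L y z -> strictly L x z.
Proof.
  intros (_ & _ & Hanti & Htr) [Hxy Hne] [Hyz _]. split; [eauto|].
  intros ->. apply Hne. now apply Hanti.
Qed.

Lemma relation_on_related (P L x y : V) : relation_on L P -> related L x y ->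
  x ∈ P /\ y ∈ P.
Proof.
  intros HL (p & Hp & HpL). destruct (HL p HpL) as (x' & y' & Hx & Hy & Hp').
  destruct (is_opair_inj _ _ _ _ _ Hp Hp'). now subst.
Qed.

Definition decreasing (f L : V) : Prop :=
  forall a b x y, a ∈ b -> related f a x -> related f b y -> strictly L y x.

(* The descending sequence below a given condition is built by recursion inside
   the countable submodel [M], always taking the eligible condition of least
   index; this is why no choice principle is needed. *)
Lemma proper_of_closed (Q P L : V) : forcing Q P L ->
  (forall p, p ∈ P -> exists q, strictly L q p) ->
  (forall w f, is_omega w -> is_function f w P -> decreasing f L ->
     exists q, q ∈ P /\ forall b x, related f b x -> related L q x) ->
  proper Q P L.
Proof.
  intros (HQ & HPO & _) Hnomin Hclosed.
  pose proof HPO as (Hrel & Hrefl & Hanti & Htr).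
  (* The argument covers every cardinal, so the threshold is 0. *)
  destruct (empty_exists Q) as [k0 Hk0]. exists k0. split.
  { split; [now apply ordinal_empty|]. intros a Ha. now destruct (Hk0 a). }
  intros k Hk _ h M Hh (w & g & Hw & Hg & Hinj) Hel p HpP HpM.
  pose proof Hel as (HQM & HMh & _).
  pose proof (H_transitive h k Hh) as Hht.
  destruct (separation (fun x => x ∈ P) M) as [A HA]; [solve_definable|].
  assert (HgA : forall x, x ∈ A -> x ∈ M) by (intros x Hx; now apply HA).
  assert (HPh : P ∈ h).
  { destruct HQ as (u & v & Hu & Hv & HQ').
    now apply (opair_components h Q P L u v Hht (HMh _ HQM)). }
  assert (Hstep : forall x, x ∈ A -> exists y, y ∈ A /\ strictly L y x).
  { intros x Hx. apply HA in Hx. destruct Hx as [HxM HxP].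
    destruct (elementary_witness Hw M h Q x x m_strictly Hel HxM HxM)
      as (y & Hy & H).
    - destruct (Hnomin x HxP) as [y Hy]. exists y. split.
      + apply (Hht P HPh). now apply (relation_on_related P L y x Hrel), Hy.
      + apply (m_strictly_correct h Q P L); trivial. now apply HMh.
    - apply (m_strictly_correct h Q P L) in H; trivial; [|now apply HMh].
      exists y. split; [apply HA; split|exact H]; trivial.
      now apply (relation_on_related P L y x Hrel), H. }
  assert (Hstep_dense : forall D x, D ∈ M -> dense_open P L D -> x ∈ A ->
    exists y, y ∈ A /\ strictly L y x /\ y ∈ D).
  { intros D x HDM (HDP & HDd & HDo) Hx. apply HA in Hx. destruct Hx as [HxM HxP].
    destruct (elementary_witness Hw M h Q x D
      (MAnd (MMem (MVar 0) (MVar 2)) m_strictly) Hel HxM HDM) as (y & Hy & HyD & H).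
    (* Going strictly below [x] first and then into [D] keeps the extension strict. *)
    - destruct (Hnomin x HxP) as [y Hy].
      assert (HyP : y ∈ P) by now apply (relation_on_related P L y x Hrel), Hy.
      destruct (HDd y HyP) as (d & HdD & Hdy). exists d. split; [|split].
      + apply (Hht D (HMh D HDM)), HdD.
      + exact HdD.
      + apply (m_strictly_correct h Q P L); trivial; [now apply HMh|].
        split; [apply (Htr d y x Hdy), Hy|]. intros ->.
        apply Hy, Hanti; [apply Hy|exact Hdy].
    - apply (m_strictly_correct h Q P L) in H; trivial; [|now apply HMh].
      exists y. splits; trivial. apply HA. auto. }
  (* As [g] is injective, at most one set has index [n]. If that set is dense open, step [n] enters
     it; otherwise the step merely descends. *)
  set (good := fun n x y : V => y ∈ A /\ strictly L y x /\
    forall D, related g D n -> dense_open P L D -> y ∈ D).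
  assert (Hgood : forall n x, x ∈ A -> exists y, y ∈ M /\ good n x y).
  { intros n x Hx.
    destruct (classic (exists D, related g D n /\ dense_open P L D))
      as [(D & HD & HDo)|Hno].
    - destruct (Hstep_dense D x (function_dom Hg D n HD) HDo Hx)
        as (y & Hy & Hyx & HyD).
      exists y. split; [auto|split; [exact Hy|split; [exact Hyx|]]]. intros D' HD' _.
      now rewrite (Hinj D' D n).
    - destruct (Hstep x Hx) as (y & Hy & Hyx). exists y.
      split; [auto|split; [exact Hy|split; [exact Hyx|]]].
      intros D HD HDo. destruct Hno. eauto. }
  destruct (omega_recursion w A p (fun n x y => good n x y /\
    forall y' i i', good n x y' -> related g y i -> related g y' i' -> ~ i' ∈ i))
    as (f & Hf & Hf0 & Hfs); trivial.
  { unfold good. solve_definable. }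
  { apply HA. auto. }
  { intros n x Hn Hx. destruct (omega_least w M g (good n x) Hg) as (y & Hy & Hgy & H).
    - unfold good. solve_definable.
    - exact (Hgood n x Hx).
    - exists y. split; [exact (proj1 Hgy)|split; [exact Hgy|exact H]]. }
  { intros n x y y' Hn Hx Hy Hy' [Hgy Hl] [Hgy' Hl'].
    destruct (function_total Hg y) as [i Hi]; [auto|].
    destruct (function_total Hg y') as [i' Hi']; [auto|].
    pose proof (Hl y' i i' Hgy' Hi Hi'). pose proof (Hl' y i' i Hgy Hi' Hi).
    destruct (proj2 (omega_ordinal Hw) i i') as [H1|[H1|H1]]; try tauto;
      try exact (function_cod Hg _ _ Hi); try exact (function_cod Hg _ _ Hi').
    subst. exact (Hinj y y' i' Hi Hi'). }
  assert (Hdec : decreasing f L).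
  { assert (Hd : forall b, b ∈ w -> forall a x y, a ∈ b ->
      related f a x -> related f b y -> strictly L y x).
    { refine (omega_induction Hw (fun b => forall a x y, a ∈ b ->
        related f a x -> related f b y -> strictly L y x) _ _ _).
      - solve_definable.
      - intros z Hz a x y Ha. now destruct (Hz a).
      - intros n m Hn Hm IH a x y Ha Hx Hy.
        destruct (function_total Hf n Hn) as [z Hz].
        destruct (Hfs n m z y Hn Hm Hz Hy) as [(_ & Hyz & _) _].
        apply Hm in Ha. destruct Ha as [Ha| ->].
        + apply (strictly_trans P L y z x HPO Hyz). eauto.
        + now rewrite (function_unique Hf n x z Hx Hz). }
    intros a b x y Ha Hx Hy. exact (Hd b (function_dom Hf b y Hy) a x y Ha Hx Hy). }
  destruct (Hclosed w f Hw) as (q & HqP & Hq).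
  { apply (function_mono f w A P Hf). intros x Hx. now apply HA. }
  { exact Hdec. }
  exists q. split.
  { destruct (empty_exists w) as [z Hz]. exact (Hq z p (Hf0 z Hz)). }
  split; [exact HqP|]. intros D HD HDo r Hr.
  destruct (function_total Hg D HD) as [n Hn].
  pose proof (function_cod Hg D n Hn) as Hnw.
  (* The set with index n is entered by the value of [f] at n + 1. Since [q] lies below that value,
     any [r] below [q] is itself a common extension. *)
  destruct (succ_exists n) as [m Hm].
  destruct (function_total Hf n Hnw) as [x Hx].
  destruct (function_total Hf m (omega_succ Hw n m Hnw Hm)) as [d Hd].
  destruct (Hfs n m x d Hnw Hm Hx Hd) as [(HdA & _ & HdD) _].
  exists d. splits; [now apply HdD|auto|]. exists r. split.
  - exact (Htr r q d Hr (Hq m d Hd)).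
  - apply Hrefl. now apply (relation_on_related P L r q Hrel).
Qed.

(** * Generic branches of trees *)

Lemma omega_exists : exists w : V, is_omega w.
Proof.
  destruct (ZF_infinity hZF) as [I HI].
  destruct (separation (fun n => forall X, inductive X -> n ∈ X) I) as [w Hw];
    [solve_definable|].
  exists w. split; [|intros X HX n Hn; apply Hw in Hn; now apply Hn]. split.
  - destruct HI as [(z & Hz & HzI) _]. exists z. split; [exact Hz|].
    apply Hw. split; [exact HzI|]. intros X [(z' & Hz' & Hz'X) _].
    now rewrite (empty_unique z z' Hz Hz').
  - intros n Hn. destruct (succ_exists n) as [m Hm]. exists m.
    split; [exact Hm|]. apply Hw in Hn.
    assert (H : forall X, inductive X -> n ∈ X -> m ∈ X).
    { intros X [_ HX] HnX. destruct (HX n HnX) as (m' & Hm' & Hm'X).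
      now rewrite (succ_unique m m' n Hm Hm'). }
    apply Hw. split; [exact (H I HI (proj1 Hn))|].
    intros X HX. exact (H X HX (proj2 Hn X HX)).
Qed.

Lemma empty_mem_omega1 (w1 z : V) : is_omega1 w1 -> is_empty z -> z ∈ w1.
Proof.
  intros Hw1 Hz. destruct omega_exists as [w Hw].
  apply (proj1 (proj1 Hw1) w (omega_mem_omega1 Hw w1 Hw1)).
  exact (omega_empty Hw z Hz).
Qed.

(** * Heights of nodes in a tree *)

Section Tree.
Context {T L : V} (HT : tree T L).

(** For an ordinal [b] this says that the strict predecessors of [x] have order type [b]. Giving the
    enumeration instead of a rank avoids transfinite recursion. *)
Definition node_height (x b : V) : Prop :=
  exists f, is_function f b T /\ increasing f L /\
    forall y, strictly L y x <-> exists c, related f c y.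

Lemma tree_rel x y : related L x y -> x ∈ T /\ y ∈ T.
Proof. apply relation_on_related, HT. Qed.

Lemma tree_refl x : x ∈ T -> related L x x.
Proof. apply HT. Qed.

Lemma tree_anti x y : related L x y -> related L y x -> x = y.
Proof. apply (proj1 HT). Qed.

Lemma tree_trans x y z : related L x y -> related L y z -> related L x z.
Proof. apply (proj1 HT). Qed.

Lemma tree_lower_chain t x y : related L x t -> related L y t ->
  related L x y \/ related L y x.
Proof. apply HT. Qed.

Lemma tree_strictly_trans x y z : strictly L x y -> strictly L y z -> strictly L x z.
Proof. exact (strictly_trans T L x y z (proj1 HT)). Qed.

Lemma tree_le_strictly_trans x y z : related L x y -> strictly L y z -> strictly L x z.
Proof.
  intros Hxy [Hyz Hne]. split; [exact (tree_trans x y z Hxy Hyz)|].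
  intros ->. now apply Hne, tree_anti.
Qed.

Lemma increasing_strictly_inv (f b c d x y : V) : ordinal b -> is_function f b T ->
  increasing f L -> related f c x -> related f d y -> strictly L x y -> c ∈ d.
Proof.
  intros Hb Hf Hinc Hx Hy [Hxy Hne].
  destruct (proj2 Hb c d (function_dom Hf c x Hx) (function_dom Hf d y Hy))
    as [H|[->|H]]; [exact H| |].
  - now destruct Hne; apply (function_unique Hf d).
  - destruct (Hinc d c y x H Hy Hx) as [Hyx _]. now destruct Hne; apply tree_anti.
Qed.

(** The enumeration for [x], restricted to [c], enumerates the predecessors of [z]. *)
Lemma node_height_below x b f c z : ordinal b -> is_function f b T ->
  increasing f L -> (forall y, strictly L y x <-> exists c, related f c y) ->
  related f c z -> node_height z c.
Proof.
  intros Hb Hf Hinc Hx Hz.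
  assert (Hcb : subset c b).
  { intros d Hd. apply (proj1 Hb c); [exact (function_dom Hf c z Hz)|exact Hd]. }
  destruct (function_exists c T (fun d y => related f d y)) as (g & Hg & H).
  { solve_definable. }
  { intros d Hd. destruct (function_total Hf d (Hcb d Hd)) as [y Hy].
    exists y. split; [exact (function_cod Hf d y Hy)|exact Hy]. }
  { intros d y y' _ _ _. apply (function_unique Hf). }
  exists g. split; [exact Hg|split].
  - intros d d' y y' Hdd Hy Hy'. apply H in Hy, Hy'.
    apply (Hinc d d'); [exact Hdd|apply Hy|apply Hy'].
  - intros y. split.
    + intros Hyz. destruct (proj1 (Hx y)) as [d Hd].
      { apply (tree_strictly_trans y z x Hyz). apply Hx. eauto. }
      exists d. apply H. splits; [|exact (function_cod Hf d y Hd)|exact Hd].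
      exact (increasing_strictly_inv f b d c y z Hb Hf Hinc Hd Hz Hyz).
    + intros [d Hd]. apply H in Hd. destruct Hd as (Hdc & _ & Hd).
      exact (Hinc d c y z Hdc Hd Hz).
Qed.

(** If x < x', the two enumerations agree by induction on the index: at a first difference the
    smaller of the two values would already occur earlier in both. Then [x], a value of [f'], is a
    value of [f], so x < x. *)
Lemma node_height_not_strictly x x' b : ordinal b -> node_height x b ->
  node_height x' b -> ~ strictly L x x'.
Proof.
  intros Hb (f & Hf & Hinc & Hx) (f' & Hf' & Hinc' & Hx') Hlt.
  assert (Heq : forall d, d ∈ b -> forall y y',
    related f d y -> related f' d y' -> y = y').
  { refine (mem_induction b
      (fun d => forall y y', related f d y -> related f' d y' -> y = y') _ _).
    { solve_definable. }
    intros d Hd IH y y' Hy Hy'.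
    assert (Hyx : strictly L y x) by (apply Hx; eauto).
    assert (Hyx' : strictly L y x') by exact (tree_strictly_trans y x x' Hyx Hlt).
    assert (Hy'x' : strictly L y' x') by (apply Hx'; eauto).
    apply NNPP. intros Hne.
    destruct (tree_lower_chain x' y y' (proj1 Hyx') (proj1 Hy'x')) as [Hyy|Hyy].
    - destruct (proj1 (Hx' y) Hyx') as [e He].
      assert (Hed : e ∈ d).
      { apply (increasing_strictly_inv f' b e d y y'); trivial. now split. }
      destruct (function_total Hf e) as [z Hz]; [exact (function_dom Hf' e y He)|].
      rewrite (IH e Hed (function_dom Hf e z Hz) z y Hz He) in Hz.
      now destruct (Hinc e d y y Hed Hz Hy).
    - destruct (proj1 (Hx y')) as [e He].
      { apply (tree_le_strictly_trans y' y x Hyy Hyx). }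
      assert (Hed : e ∈ d).
      { apply (increasing_strictly_inv f b e d y' y); trivial.
        split; [exact Hyy|congruence]. }
      destruct (function_total Hf' e) as [z Hz]; [exact (function_dom Hf e y' He)|].
      rewrite <- (IH e Hed (function_dom Hf' e z Hz) y' z He Hz) in Hz.
      now destruct (Hinc' e d y' y' Hed Hz Hy'). }
  destruct (proj1 (Hx' x) Hlt) as [c Hc].
  destruct (function_total Hf c) as [z Hz]; [exact (function_dom Hf' c x Hc)|].
  rewrite (Heq c (function_dom Hf' c x Hc) z x Hz Hc) in Hz.
  now destruct (proj2 (Hx x) (ex_intro _ c Hz)).
Qed.

(** The filter lives in a cone, and nodes of small height lie under the root of the cone; hence
    heights are sought in the downward closure of [G]. *)
Definition below (G x : V) : Prop := exists g, g ∈ G /\ related L x g.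

Lemma chain_below_comparable G x y : chain G L -> below G x -> below G y ->
  related L x y \/ related L y x.
Proof.
  intros HG (g & Hg & Hx) (h & Hh & Hy). destruct (HG g h Hg Hh) as [H|H].
  - apply (tree_lower_chain h); [exact (tree_trans x g h Hx H)|exact Hy].
  - apply (tree_lower_chain g); [exact Hx|exact (tree_trans y h g Hy H)].
Qed.

(** This uniqueness takes the place of choice when nodes of all heights are gathered into one
    sequence. *)
Lemma chain_node_height_unique G b x y : chain G L -> ordinal b ->
  below G x -> below G y -> node_height x b -> node_height y b -> x = y.
Proof.
  intros HG Hb HGx HGy Hx Hy. apply NNPP. intros Hne.
  destruct (chain_below_comparable G x y HG HGx HGy) as [H|H].
  - apply (node_height_not_strictly x y b); trivial. now split.
  - apply (node_height_not_strictly y x b); trivial. split; [exact H|congruence].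
Qed.

(** Each [b] is sent to the node of height [b] under the chain. Since predecessors of such nodes are
    again under the chain and have smaller heights, the range is closed downwards. *)
Lemma chain_enumeration G a : chain G L -> ordinal a ->
  (forall b, b ∈ a -> exists x, below G x /\ node_height x b) ->
  exists f, is_function f a T /\ increasing f L /\
    (forall b x, related f b x -> below G x) /\
    (forall b x y, related f b x -> strictly L y x -> exists c, related f c y).
Proof.
  intros HG Ha Hex.
  destruct (function_exists a T (fun b x => below G x /\ node_height x b))
    as (f & Hf & H).
  { unfold below, node_height. solve_definable. }
  { intros b Hb. destruct (Hex b Hb) as (x & (g & Hg & Hx) & Hxb).
    exists x. split; [now apply (tree_rel x g)|]. split; [|exact Hxb]. now exists g. }
  { intros b x y Hb _ _ [Hx Hxb] [Hy Hyb].
    exact (chain_node_height_unique G b x y HG (ordinal_mem a b Ha Hb) Hx Hy Hxb Hyb). }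
  assert (Hdown : forall b x y, related f b x -> strictly L y x ->
    exists c, c ∈ b /\ related f c y).
  { intros b x y Hx Hyx. apply H in Hx.
    destruct Hx as (Hb & _ & (g & Hg & Hxg) & h & Hh & Hinc & Hpred).
    destruct (proj1 (Hpred y) Hyx) as [c Hc]. exists c.
    pose proof (function_dom Hh c y Hc) as Hcb. split; [exact Hcb|]. apply H. splits.
    - now apply (proj1 Ha b).
    - exact (function_cod Hh c y Hc).
    - exists g. split; [exact Hg|]. exact (tree_trans y x g (proj1 Hyx) Hxg).
    - exact (node_height_below x b h c y (ordinal_mem a b Ha Hb) Hh Hinc Hpred Hc). }
  exists f. splits; trivial.
  - intros b c x y Hbc Hx Hy. pose proof (proj1 (H c y) Hy) as
      (Hc & _ & (g & Hg & Hyg) & h & Hh & Hinc & Hpred).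
    (* The predecessor [z] of [y] with index [b] has height [b] and lies under [G], so it is [x]. *)
    destruct (function_total Hh b Hbc) as [z Hz].
    assert (Hzy : strictly L z y) by (apply Hpred; eauto).
    replace x with z; [exact Hzy|]. apply (function_unique Hf b); [|exact Hx].
    apply H. splits.
    + exact (function_dom Hf b x Hx).
    + exact (function_cod Hh b z Hz).
    + exists g. split; [exact Hg|]. exact (tree_trans z y g (proj1 Hzy) Hyg).
    + exact (node_height_below y c h b z (ordinal_mem a c Ha Hc) Hh Hinc Hpred Hz).
  - intros b x Hx. now apply H in Hx.
  - intros b x y Hx Hyx. destruct (Hdown b x y Hx Hyx) as (c & _ & Hc). eauto.
Qed.

(** The nodes [u] and [x] are separate because [t] may already lie above its predecessor of height
    [b]. *)
Definition height_dense (b : V) : Prop :=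
  forall t, t ∈ T -> exists u, related L t u /\
    exists x, related L x u /\ node_height x b.

(** * Generic chains and the induction on heights *)

Section Closed.
Context {w1 : V} (Hw1 : is_omega1 w1) (hPFA : PFA V).
Context (Hclosed : closed_tree w1 T L) (Hnomax : no_maximal T L).

(* The forcing is the part of the tree above [s], upside down. *)
Lemma generic_chain a s : subset a w1 -> s ∈ T ->
  (forall b, b ∈ a -> height_dense b) ->
  exists G, chain G L /\ s ∈ G /\
    forall b, b ∈ a -> exists x, below G x /\ node_height x b.
Proof.
  intros Ha Hs Hdense.
  destruct (separation (fun t => related L s t) T) as [P HP]; [solve_definable|].
  destruct (relation_exists P P (fun x y => related L y x)) as (R & HR1 & HR);
    [solve_definable|].
  assert (HPL : forall x y, x ∈ P -> related L x y -> y ∈ P).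
  { intros x y Hx Hxy. apply HP in Hx. apply HP.
    split; [now apply (tree_rel x)|]. apply (tree_trans s x); tauto. }
  assert (HsP : s ∈ P) by (apply HP; auto using tree_refl).
  assert (HRs : forall x y, strictly R y x -> strictly L x y).
  { intros x y [H Hne]. apply HR in H. split; [apply H|congruence]. }
  assert (Hforcing : forcing (opair P R) P R).
  { split; [apply opair_spec|]. split; [split; [|splits]|].
    - intros p Hp. destruct (HR1 p Hp) as (x & y & H). now exists x, y.
    - intros x Hx. apply HR. splits; trivial. apply tree_refl. now apply HP.
    - intros x y Hxy Hyx. apply HR in Hxy, Hyx. apply tree_anti; tauto.
    - intros x y z Hxy Hyz. apply HR in Hxy, Hyz. apply HR.
      splits; try tauto. apply (tree_trans z y x); tauto.
    - exists s. split; [exact HsP|]. intros p Hp. apply HR. splits; trivial.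
      now apply HP. }
  assert (Hproper : proper (opair P R) P R).
  { apply proper_of_closed; [exact Hforcing| |].
    - intros p Hp. destruct (Hnomax p) as (q & Hq & Hpq & Hne); [now apply HP|].
      exists q. split; [|congruence]. apply HR. splits; trivial.
      exact (HPL p q Hp Hpq).
    - intros w f Hw Hf Hdec.
      destruct (Hclosed w f) as (t & Ht & Hub).
      + exact (omega_mem_omega1 Hw w1 Hw1).
      + apply (function_mono f w P T Hf). intros x Hx. now apply HP.
      + intros b c x y Hbc Hx Hy. apply HRs. exact (Hdec b c x y Hbc Hx Hy).
      (* The sequence is nonempty, so its upper bound lies above its value at 0 and stays in the
         cone. *)
      + assert (HtP : t ∈ P).
        { destruct (empty_exists w) as [z Hz].
          destruct (function_total Hf z (omega_empty Hw z Hz)) as [x Hx].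
          apply (HPL x); [exact (function_cod Hf z x Hx)|]. exact (Hub z x Hx). }
        exists t. split; [exact HtP|]. intros b x Hx. apply HR.
        splits; [exact HtP|exact (function_cod Hf b x Hx)|exact (Hub b x Hx)]. }
  destruct (ZF_power hZF P) as [PP HPP].
  (* The family of dense sets must be indexed by all of omega1; for [b] outside [a] the condition is
     vacuous and the set is the whole poset. *)
  set (deep := fun b u : V => b ∈ a -> exists x, related L x u /\ node_height x b).
  destruct (function_exists w1 PP (fun b D => forall u, u ∈ D <-> u ∈ P /\ deep b u))
    as (F & HF & HFD).
  { unfold deep, node_height. solve_definable. }
  { intros b Hb. destruct (separation (deep b) P) as [D HD].
    - unfold deep, node_height. solve_definable.
    - exists D. split; [|exact HD]. apply HPP. intros u Hu. now apply HD. }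
  { intros b D D' _ _ _ HD HD'. apply (ZF_extensionality hZF). intros u.
    now rewrite HD, HD'. }
  destruct (hPFA (opair P R) P R Hforcing Hproper w1 PP F Hw1 HF) as (G & HG & Hmeet).
  { intros b D HbD. apply HFD in HbD. destruct HbD as (_ & _ & HD). split; [|split].
    - intros u Hu. now apply HD.
    - intros p Hp. destruct (classic (b ∈ a)) as [Hb|Hb].
      + destruct (Hdense b Hb p) as (u & Hpu & Hu); [now apply HP|].
        exists u. pose proof (HPL p u Hp Hpu) as HuP. split.
        * apply HD. split; [exact HuP|]. now intros _.
        * apply HR. auto.
      + exists p. split; [apply HD; split; [exact Hp|now intros]|].
        apply HR. splits; trivial. apply tree_refl. now apply HP.
    - intros d p Hd Hpd. apply HR in Hpd. apply HD in Hd. apply HD.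
      split; [tauto|]. intros Hb. destruct Hd as [_ Hd].
      destruct (Hd Hb) as (x & Hx & Hxb). exists x. split; [|exact Hxb].
      apply (tree_trans x d p); tauto. }
  destruct HG as (HGP & (p & Hp) & Hup & Hdir).
  exists G. splits.
  - intros x y Hx Hy. destruct (Hdir x y Hx Hy) as (r & _ & Hrx & Hry).
    apply HR in Hrx, Hry. apply (tree_lower_chain r); tauto.
  - apply (Hup p s Hp), HR. pose proof (HGP p Hp) as HpP. splits; trivial.
    now apply HP.
  - intros b Hb. destruct (function_total HF b (Ha b Hb)) as [D HbD].
    destruct (Hmeet b D HbD) as (g & Hg & HgD). apply HFD in HbD. apply HbD in HgD.
    destruct HgD as [_ Hdeep]. destruct (Hdeep Hb) as (x & Hx & Hxb).
    exists x. split; [now exists g|exact Hxb].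
Qed.

Lemma height_dense_step a : a ∈ w1 -> (forall b, b ∈ a -> height_dense b) ->
  height_dense a.
Proof.
  intros Ha IH t Ht.
  assert (Hao : ordinal a) by exact (ordinal_mem w1 a (proj1 Hw1) Ha).
  destruct (generic_chain a t (proj1 (proj1 Hw1) a Ha) Ht IH) as (G & HG & HtG & Hex).
  destruct (chain_enumeration G a HG Hao Hex) as (f & Hf & Hinc & HfG & Hdown).
  assert (Hu : exists u, related L t u /\ forall b x, related f b x -> strictly L x u).
  (* If a value of [f] is above [t], so is any upper bound [v], and a node above [v] makes the
     inequalities strict. Otherwise comparability under [G] puts all values strictly below [t], and
     [u] is [t]. Zero, successor and limit stages are treated alike. *)
  { destruct (classic (exists b x, related f b x /\ related L t x))
      as [(b & x & Hbx & Htx)|Hno].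
    - destruct (Hclosed a f Ha Hf Hinc) as (v & HvT & Hv).
      destruct (Hnomax v HvT) as (u & _ & Hvu). exists u. split.
      + apply (tree_trans t x u Htx), (tree_trans x v u (Hv b x Hbx)), Hvu.
      + intros c y Hcy. exact (tree_le_strictly_trans y v u (Hv c y Hcy) Hvu).
    - exists t. split; [now apply tree_refl|]. intros b x Hbx.
      assert (HGt : below G t) by (exists t; auto using tree_refl).
      destruct (chain_below_comparable G x t HG (HfG b x Hbx) HGt) as [H|H].
      + split; [exact H|]. intros ->. apply Hno. exists b, t. auto.
      + destruct Hno. eauto. }
  destruct Hu as (u & Htu & Hfu). exists u. split; [exact Htu|].
  (* The node of height [a] is a minimal one among the nodes up to [u] that lie strictly above the
     range of [f]. *)
  destruct (separation (fun y => related L y u /\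
    forall b x, related f b x -> strictly L x y) T) as [X HX]; [solve_definable|].
  destruct (proj1 (proj2 HT) X) as (x & Hx & Hmin).
  { intros y Hy. now apply HX. }
  { exists u. apply HX. pose proof (proj2 (tree_rel t u Htu)) as HuT.
    auto using tree_refl. }
  apply HX in Hx. destruct Hx as (HxT & Hxu & Hfx). exists x. split; [exact Hxu|].
  exists f. splits; trivial. intros y. split; [|intros [c Hc]; eauto].
  (* A predecessor [y] of [x] outside the range of [f] lies strictly above all values, since the
     range is closed downwards; this contradicts the minimality of [x]. *)
  intros Hyx. apply NNPP. intros Hno. apply (Hmin y); [|exact Hyx].
  apply HX. pose proof (tree_trans y x u (proj1 Hyx) Hxu) as Hyu.
  splits; [now apply (tree_rel y u)|exact Hyu|]. intros b z Hz.
  destruct (tree_lower_chain u z y (proj1 (Hfu b z Hz)) Hyu) as [H|H].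
  - split; [exact H|]. intros ->. eauto.
  - destruct Hno. destruct (classic (y = z)) as [->|Hne]; [eauto|].
    apply (Hdown b z y Hz). now split.
Qed.

Lemma all_heights_dense a : a ∈ w1 -> height_dense a.
Proof.
  revert a. refine (mem_induction w1 height_dense _ _).
  - unfold height_dense, node_height. solve_definable.
  - intros a Ha IH. apply (height_dense_step a Ha). intros b Hb.
    apply IH; [exact Hb|]. now apply (proj1 (proj1 Hw1) a).
Qed.

Lemma omega1_branch : exists C, subset C T /\ chain C L /\ has_order_type C L w1.
Proof.
  destruct (empty_exists T) as [z Hz].
  (* The empty set serves both as the index 0 and as the empty sequence; its upper bound is a node
     to start from. *)
  destruct (Hclosed z z (empty_mem_omega1 w1 z Hw1 Hz)) as (s & Hs & _).
  { split; [intros p Hp; now destruct (Hz p)|intros x Hx; now destruct (Hz x)]. }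
  { intros a b x y Hab. intros (p & _ & Hp). now destruct (Hz p). }
  destruct (generic_chain w1 s (fun b Hb => Hb) Hs all_heights_dense)
    as (G & HG & _ & Hex).
  destruct (chain_enumeration G w1 HG (proj1 Hw1) Hex) as (f & Hf & Hinc & HfG & _).
  destruct (separation (fun x => exists b, related f b x) T) as [C HC];
    [solve_definable|].
  exists C. splits.
  - intros x Hx. now apply HC.
  - intros x y Hx Hy. apply HC in Hx, Hy.
    destruct Hx as (_ & b & Hb), Hy as (_ & c & Hc).
    apply (chain_below_comparable G); eauto.
  - exists f. splits.
    + split; [|apply Hf]. intros p Hp.
      destruct (proj1 Hf p Hp) as (b & x & Hb & Hx & Hbx).
      exists b, x. splits; trivial. apply HC. split; [exact Hx|]. exists b, p. auto.
    + intros b c x Hb Hc.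
      destruct (proj2 (proj1 Hw1) b c (function_dom Hf b x Hb) (function_dom Hf c x Hc))
        as [H|[H|H]]; [|exact H|].
      * now destruct (Hinc b c x x H Hb Hc).
      * now destruct (Hinc c b x x H Hc Hb).
    + intros x Hx. now apply HC in Hx.
    + intros b c x y Hb Hc. split; [intros H; exact (Hinc b c x y H Hb Hc)|].
      exact (increasing_strictly_inv f w1 b c x y (proj1 Hw1) Hf Hinc Hb Hc).
Qed.

End Closed.
End Tree.
End Model.

Theorem proposition5p2 (V : set_structure) (hZF : ZF V) :
  PFA V -> DC_omega1 V.
Proof.
  intros hPFA w1 Hw1 T L HT Hclosed Hnomax.
  exact (omega1_branch hZF HT Hw1 hPFA Hclosed Hnomax).
Qed.
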